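(* Let $X_d$ denote either $C(\mathbb{R}^d)$ or $\mathcal{D}(\mathbb{R}^d)'$. Let $h_1,\dots,h_t\in\mathbb{R}^d$ be such that the subgroup $h_1\mathbb{Z}+\dots+h_t\mathbb{Z}$ is dense in $\mathbb{R}^d$, let $f\in X_d$, and suppose there are natural numbers $m_1,\dots,m_t$ such that for every $k\in\{1,\dots,t\}$, $\Delta_{h_k}^{m_k}f$ is (in distributional sense) a continuous exponential polynomial. Then $f$ is (in distributional sense) a continuous exponential polynomial.
   Context: $C(\mathbb{R}^d)$ is the space of continuous complex valued functions on $\mathbb{R}^d$ and $\mathcal{D}(\mathbb{R}^d)'$ the space of complex valued Schwartz distributions. For a function $f$: $(\tau_yf)(x)=f(x+y)$ and $\Delta_h^mf=\sum_{k=0}^m\binom{m}{k}(-1)^{m-k}\tau_{kh}f$. For a distribution $f$ and test function $\varphi$: $(\Delta_h^mf)\{\varphi\}=f\{\Delta_{-h}^m\varphi\}$. A continuous exponential polynomial on $\mathbb{R}^d$ is a function of the form $x\mapsto\sum_{j=1}^r p_j(x)e^{\langle\lambda_j,x\rangle}$ with polynomials $p_j$ and $\lambda_j\in\mathbb{C}^d$; a distribution is a continuous exponential polynomial in distributional sense if it is the distribution $\varphi\mapsto\int e\varphi$ induced by such a function $e$. *)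

(* Defs.v *)
From Stdlib Require Import Reals ZArith.
From mathcomp Require Import ssreflect ssrfun ssrbool eqtype ssrnat seq choice fintype finfun bigop.
Set Implicit Arguments. Unset Strict Implicit.
Open Scope R_scope.

Definition Cplx := (R * R)%type.
Definition C0 : Cplx := (0, 0).
Definition RtoC (r : R) : Cplx := (r, 0).
Definition Cadd (z w : Cplx) : Cplx := (fst z + fst w, snd z + snd w).
Definition Copp (z : Cplx) : Cplx := (- fst z, - snd z).
Definition Csub (z w : Cplx) : Cplx := Cadd z (Copp w).
Definition Cmul (z w : Cplx) : Cplx :=
  (fst z * fst w - snd z * snd w, fst z * snd w + snd z * fst w).
Definition Cexp (z : Cplx) : Cplx :=
  (exp (fst z) * cos (snd z), exp (fst z) * sin (snd z)).
Definition Cnorm (z : Cplx) : R := sqrt (fst z ^ 2 + snd z ^ 2).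
Definition Cv (u : nat -> Cplx) (l : Cplx) : Prop :=
  Un_cv (fun n => fst (u n)) (fst l) /\ Un_cv (fun n => snd (u n)) (snd l).

Definition Pt (d : nat) := 'I_d -> R.
Definition vadd d (x y : Pt d) : Pt d := fun i => x i + y i.
Definition vscal d (a : R) (x : Pt d) : Pt d := fun i => a * x i.
Definition vnorm d (x : Pt d) : R := sqrt (\big[Rplus/0]_(i < d) (x i ^ 2)).
Definition unit_vec d (i : 'I_d) : Pt d := fun j => if j == i then 1 else 0.

Definition Fn (d : nat) := Pt d -> Cplx.

Definition Ccont d (f : Fn d) : Prop :=
  forall x eps, 0 < eps -> exists del, 0 < del /\
    forall y, vnorm (vadd y (vscal (-1) x)) < del -> Cnorm (Csub (f y) (f x)) < eps.

Definition Ftau d (y : Pt d) (f : Fn d) : Fn d := fun x => f (vadd x y).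
Definition FDelta d (h : Pt d) (m : nat) (f : Fn d) : Fn d := fun x =>
  \big[Cadd/C0]_(k < m.+1)
     Cmul (RtoC (Binomial.C m k * (-1) ^ (m - k)%nat)) (Ftau (vscal (INR k) h) f x).

Definition monom d (a : 'I_d -> nat) (x : Pt d) : R := \big[Rmult/1]_(i < d) (x i ^ a i).
Definition poly_eval d (p : seq (Cplx * ('I_d -> nat))) (x : Pt d) : Cplx :=
  foldr (fun ca acc => Cadd (Cmul ca.1 (RtoC (monom ca.2 x))) acc) C0 p.
Definition cdot d (lam : 'I_d -> Cplx) (x : Pt d) : Cplx :=
  (\big[Rplus/0]_(i < d) (fst (lam i) * x i), \big[Rplus/0]_(i < d) (snd (lam i) * x i)).
Definition is_exp_poly d (e : Fn d) : Prop :=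
  exists terms : seq (seq (Cplx * ('I_d -> nat)) * ('I_d -> Cplx)),
    forall x, e x = foldr (fun pl acc => Cadd (Cmul (poly_eval pl.1 x) (Cexp (cdot pl.2 x))) acc)
                          C0 terms.

Definition has_partial d (i : 'I_d) (f g : Fn d) : Prop := forall x,
  derivable_pt_lim (fun s => fst (f (vadd x (vscal s (unit_vec i))))) 0 (fst (g x)) /\
  derivable_pt_lim (fun s => snd (f (vadd x (vscal s (unit_vec i))))) 0 (snd (g x)).
(* D l = the iterated partial derivative of f along the coordinate list l *)
Definition deriv_family d (f : Fn d) (D : seq 'I_d -> Fn d) : Prop :=
  D [::] = f /\ forall l, Ccont (D l) /\ forall i, has_partial i (D l) (D (i :: l)).
Definition supp_in d (f : Fn d) (r : R) : Prop := forall x, r < vnorm x -> f x = C0.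
Definition test_fn d (phi : Fn d) : Prop :=
  (exists D, deriv_family phi D) /\ (exists r, supp_in phi r).
Definition test_conv d (phis : nat -> Fn d) (phi : Fn d) : Prop :=
  exists r, supp_in phi r /\ (forall n, supp_in (phis n) r) /\
  exists (Ds : nat -> seq 'I_d -> Fn d) (D : seq 'I_d -> Fn d),
    deriv_family phi D /\ (forall n, deriv_family (phis n) (Ds n)) /\
    forall l eps, 0 < eps -> exists N, forall n x, (N <= n)%nat ->
      Cnorm (Csub (Ds n l x) (D l x)) < eps.

(* a functional, only its values on test functions matter *)
Definition distribution d (T : Fn d -> Cplx) : Prop :=
  (forall phi psi, test_fn phi -> test_fn psi ->
     T (fun x => Cadd (phi x) (psi x)) = Cadd (T phi) (T psi)) /\
  (forall c phi, test_fn phi -> T (fun x => Cmul c (phi x)) = Cmul c (T phi)) /\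
  (forall phis phi, (forall n, test_fn (phis n)) -> test_fn phi ->
     test_conv phis phi -> Cv (fun n => T (phis n)) (T phi)).

Definition DeltaD d (h : Pt d) (m : nat) (T : Fn d -> Cplx) : Fn d -> Cplx :=
  fun phi => T (FDelta (vscal (-1) h) m phi).

(* Riemann sums on the grid (Z/(n+1))^d cut to the cube [-n^2/(n+1), n^2/(n+1)]^d;
   for continuous compactly supported g they converge to the integral over R^d. *)
Definition riemann_sum d (g : Fn d) (n : nat) : Cplx :=
  \big[Cadd/C0]_(k : {ffun 'I_d -> 'I_(S (2 * n * n)%nat)})
     Cmul (RtoC (/ (INR n.+1 ^ d)))
          (g (fun i => (INR (k i) - INR (n * n)%nat) / INR n.+1)).

(* T is the distribution phi |-> int e phi *)
Definition induced d (e : Fn d) (T : Fn d -> Cplx) : Prop :=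
  forall phi, test_fn phi -> Cv (riemann_sum (fun x => Cmul (e x) (phi x))) (T phi).
Definition dist_exp_poly d (T : Fn d -> Cplx) : Prop :=
  exists e, is_exp_poly e /\ induced e T.

Definition dense_subgroup d t (h : 'I_t -> Pt d) : Prop :=
  forall (x : Pt d) eps, 0 < eps -> exists z : 'I_t -> Z,
    vnorm (vadd (fun i => \big[Rplus/0]_(k < t) (IZR (z k) * h k i)) (vscal (-1) x)) < eps.

(* Main.v *)
From Coquelicot Require Complex.
From Coquelicot Require Import Rcomplements Hierarchy Derive RInt RInt_analysis Continuity.
Require Import Defs.
From Stdlib Require Import Reals ZArith Lra Lia.
From HB Require Import structures.
From mathcomp Require Import ssreflect ssrfun ssrbool eqtype ssrnat seq choice fintype finfun bigop.
From mathcomp Require Import boolp classical_sets fsbigop Rstruct ssrZ.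
From mathcomp Require ssralg poly complex.

Set Implicit Arguments.
Unset Strict Implicit.
Unset Printing Implicit Defensive.

Open Scope R_scope.

(** Both cases rest on one finite-dimensionality argument.  Let [A y] be the translate by [y] of
    the given object, seen as a function of a point (case C(R^d)) or of a test function (case
    D').  Exponential polynomials have finite-dimensional spaces of translates, so modulo a
    finite-dimensional space [A] satisfies a two-sided recurrence in each direction [h k]; hence
    [A] stays in a finite-dimensional space on the whole group.  A finite-dimensional function
    space is reproduced by finitely many points, [w = sum_i w(x_i) v_i], an identity that
    survives limits; by density and continuity it holds for [A y] with every [y].

    A continuous function whose translates span a finite-dimensional space is an exponential
    polynomial.  In one variable, the span is invariant under differentiation (look at averages
    of translates), so the function solves a linear ODE with constant coefficients; the case of
    several variables follows one variable at a time.

    For a distribution [T], put [F_phi y = T (phi (. - y))].  By the above, the [F_phi] are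
    exponential polynomials in the span of finitely many [F_(phi_i)].  Commutativity of
    convolution reads [int F_psi phi = int F_phi psi], so if [phi] is orthogonal to all
    [F_(phi_i)], then [F_phi] is orthogonal to every test function, whence [T phi = F_phi 0 = 0].
    Thus [T] vanishes on the common kernel of the functionals [phi |-> int F_(phi_i) phi], and is
    a linear combination of them. *)

(** * Complex numbers *)

Definition Cinv : Cplx -> Cplx := Complex.Cinv.
Definition Cdiv (z w : Cplx) : Cplx := Cmul z (Cinv w).
Definition Cconj (z : Cplx) : Cplx := (fst z, - snd z).

Declare Scope cplx_scope.
Delimit Scope cplx_scope with C.
Bind Scope cplx_scope with Cplx.
Arguments Cnorm z%_C.
Arguments Cexp z%_C.
Arguments Cv u l%_C.

Notation "0" := C0 : cplx_scope.
Notation "x %:C" := (RtoC x) (at level 1, format "x %:C").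
Notation "1" := (RtoC 1) : cplx_scope.
Notation "z + w" := (Cadd z w) : cplx_scope.
Notation "- z" := (Copp z) : cplx_scope.
Notation "- 1" := (- (1))%C : cplx_scope.
Notation "z - w" := (Csub z w) : cplx_scope.
Notation "z * w" := (Cmul z w) : cplx_scope.
Notation "/ z" := (Cinv z) : cplx_scope.
Notation "z / w" := (Cdiv z w) : cplx_scope.
Notation "\sum_ ( i <- r | P ) F" := (\big[Cadd/C0]_(i <- r | P%B) F%C) : cplx_scope.
Notation "\sum_ ( i <- r ) F" := (\big[Cadd/C0]_(i <- r) F%C) : cplx_scope.
Notation "\sum_ ( i < n ) F" := (\big[Cadd/C0]_(i < n) F%C) : cplx_scope.
Notation "\prod_ ( i <- r ) F" := (\big[Cmul/RtoC 1]_(i <- r) F%C) : cplx_scope.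
Notation "\prod_ ( i < n ) F" := (\big[Cmul/RtoC 1]_(i < n) F%C) : cplx_scope.

Lemma Cplx_field_theory : field_theory C0 (RtoC 1) Cadd Cmul Csub Copp Cdiv Cinv eq.
Proof. exact: Complex.C_field_theory. Qed.

Add Field Cplx_field : Cplx_field_theory.

Lemma CaddA : associative Cadd. Proof. by move=> *; ring. Qed.
Lemma CaddC : commutative Cadd. Proof. by move=> *; ring. Qed.
Lemma Cadd0z : left_id C0 Cadd. Proof. by move=> *; ring. Qed.
Lemma CmulA : associative Cmul. Proof. by move=> *; ring. Qed.
Lemma CmulC : commutative Cmul. Proof. by move=> *; ring. Qed.
Lemma Cmul1z : left_id (RtoC 1) Cmul. Proof. by move=> *; ring. Qed.
Lemma Cmul0z : left_zero C0 Cmul. Proof. by move=> *; ring. Qed.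
Lemma Cmulz0 : right_zero C0 Cmul. Proof. by move=> *; ring. Qed.
Lemma CmulDl : left_distributive Cmul Cadd. Proof. by move=> *; ring. Qed.
Lemma CmulDr : right_distributive Cmul Cadd. Proof. by move=> *; ring. Qed.
HB.instance Definition _ := Monoid.isComLaw.Build Cplx C0 Cadd CaddA CaddC Cadd0z.
HB.instance Definition _ := Monoid.isComLaw.Build Cplx (RtoC 1) Cmul CmulA CmulC Cmul1z.
HB.instance Definition _ := Monoid.isMulLaw.Build Cplx C0 Cmul Cmul0z Cmulz0.
HB.instance Definition _ := Monoid.isAddLaw.Build Cplx Cmul Cadd CmulDl CmulDr.

Lemma CsubE z w : (z - w = z + - 1 * w)%C. Proof. by ring. Qed.
Lemma Csubz0 z : (z - 0 = z)%C. Proof. by ring. Qed.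

Section ComplexSums.
Local Open Scope cplx_scope.
Variables (I : Type) (r : seq I) (P : pred I).
Implicit Types (F G : I -> Cplx) (z : Cplx).

Lemma Cmul_sumr F z : z * (\sum_(i <- r | P i) F i) = \sum_(i <- r | P i) (z * F i).
Proof. exact: (big_distrr (times := Cmul)). Qed.

Lemma Csum_lin F G z :
  \sum_(i <- r | P i) (F i + z * G i) = \sum_(i <- r | P i) F i + z * \sum_(i <- r | P i) G i.
Proof. by rewrite Cmul_sumr -big_split. Qed.

Lemma CsumB F G :
  \sum_(i <- r | P i) (F i - G i) = \sum_(i <- r | P i) F i - \sum_(i <- r | P i) G i.
Proof.
by rewrite CsubE -Csum_lin; apply: eq_bigr => i _; rewrite CsubE.
Qed.

Lemma fst_sum F : fst (\sum_(i <- r | P i) F i) = \big[Rplus/0%R]_(i <- r | P i) fst (F i).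
Proof. by apply: (big_morph fst). Qed.

End ComplexSums.

Lemma Csub_eq0 z w : (z - w = 0)%C -> z = w.
Proof. by move=> zw0; have ->: z = (z - w + w)%C; [ring | rewrite zw0; ring]. Qed.

Lemma RtoCD a b : (a + b)%:C = (a%:C + b%:C)%C.
Proof. by rewrite /RtoC /Cadd /=; congr pair; ring. Qed.
Lemma RtoCM a b : (a * b)%:C = (a%:C * b%:C)%C.
Proof. by rewrite /RtoC /Cmul /=; congr pair; ring. Qed.
Lemma RtoC_inj : injective RtoC. Proof. by move=> a b []. Qed.

Lemma RtoC_prod (I : Type) (r : seq I) (F : I -> R) :
  (\big[Rmult/1]_(i <- r) F i)%:C = (\prod_(i <- r) (F i)%:C)%C.
Proof. by apply: (big_morph RtoC) => // a b; exact: RtoCM. Qed.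

Lemma Csum_const (I : Type) (r : seq I) z : (\sum_(i <- r) z = (INR (size r))%:C * z)%C.
Proof.
elim: r => [|i r IH]; first by rewrite big_nil /= (_ : 0%:C = 0%C) //; ring.
by rewrite big_cons IH -[size (i :: r)]/(size r).+1 S_INR RtoCD; ring.
Qed.

Lemma CexpD z w : Cexp (z + w) = (Cexp z * Cexp w)%C.
Proof. by rewrite /Cexp /Cmul /= exp_plus cos_plus sin_plus; congr pair; ring. Qed.
Lemma Cexp0 : Cexp 0 = 1%C.
Proof. by rewrite /Cexp /= exp_0 cos_0 sin_0; congr pair; ring. Qed.

Lemma Cnorm_ge0 z : 0 <= Cnorm z. Proof. exact: sqrt_pos. Qed.
Lemma Cnorm_triangle z w : Cnorm (z + w) <= Cnorm z + Cnorm w.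
Proof. exact: Complex.Cmod_triangle. Qed.
Lemma CnormM z w : Cnorm (z * w) = Cnorm z * Cnorm w.
Proof. exact: Complex.Cmod_mult. Qed.
Lemma CnormN z : Cnorm (- z) = Cnorm z.
Proof. exact: Complex.Cmod_opp. Qed.
Lemma Cnorm0 : Cnorm 0 = 0. Proof. exact: Complex.Cmod_0. Qed.
Lemma Cnorm_eq0 z : Cnorm z = 0 -> z = 0%C. Proof. exact: Complex.Cmod_eq_0. Qed.
Lemma Cnorm_RtoC x : Cnorm x%:C = Rabs x. Proof. exact: Complex.Cmod_R. Qed.

Lemma Cnorm_subC z w : Cnorm (z - w) = Cnorm (w - z).
Proof. by rewrite -CnormN; congr Cnorm; ring. Qed.

Lemma Cnorm_sub_triangle z w v : Cnorm (z - v) <= Cnorm (z - w) + Cnorm (w - v).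
Proof. by have ->: (z - v = z - w + (w - v))%C; [ring | exact: Cnorm_triangle]. Qed.

Lemma Rabs_fst_le z : Rabs (fst z) <= Cnorm z.
Proof. exact: Rle_trans (Rmax_l _ _) (Complex.Rmax_Cmod z). Qed.
Lemma Rabs_snd_le z : Rabs (snd z) <= Cnorm z.
Proof. exact: Rle_trans (Rmax_r _ _) (Complex.Rmax_Cmod z). Qed.

Lemma Cnorm_le_sum z : Cnorm z <= Rabs (fst z) + Rabs (snd z).
Proof.
have [fst0 snd0] := (Rabs_pos (fst z), Rabs_pos (snd z)).
rewrite /Cnorm -[X in _ <= X]sqrt_pow2; last lra.
by apply: sqrt_le_1_alt; rewrite -(pow2_abs (fst z)) -(pow2_abs (snd z)); nra.
Qed.

Lemma Cnorm_sum_le (I : eqType) (r : seq I) (F : I -> Cplx) B :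
  (forall i, i \in r -> Cnorm (F i) <= B) -> Cnorm (\sum_(i <- r) F i) <= INR (size r) * B.
Proof.
elim: r => [|i r IH] FB; first by rewrite big_nil Cnorm0 /=; lra.
rewrite big_cons -[size (i :: r)]/(size r).+1 S_INR; apply: Rle_trans (Cnorm_triangle _ _) _.
have := FB i (mem_head i r); have := IH (fun j jr => FB j (@mem_behead _ (i :: r) j jr)); lra.
Qed.

Lemma subst_eqfun (A B : Type) (P : (A -> B) -> Prop) f g : P f -> f =1 g -> P g.
Proof. by move=> Pf /funext <-. Qed.

(** * Finite-dimensional spaces of functions *)

Section Span.
Variable X : Type.
Local Open Scope cplx_scope.
Implicit Types (u v w : X -> Cplx) (s t : seq (X -> Cplx)) (V : (X -> Cplx) -> Prop).

Fixpoint in_span s w : Prop :=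
  if s is u :: s' then exists c, in_span s' (fun x => w x - c * u x)
  else w =1 fun=> 0.

Definition subspace V :=
  V (fun=> 0) /\ forall c u v, V u -> V v -> V (fun x => u x + c * v x).

Lemma subspaceD V u v : subspace V -> V u -> V v -> V (fun x => u x + v x).
Proof. by move=> [_ lin] Vu Vv; apply: subst_eqfun (lin 1 _ _ Vu Vv) _ => x; ring. Qed.

Lemma subspaceZ V c u : subspace V -> V u -> V (fun x => c * u x).
Proof. by move=> [V0 lin] Vu; apply: subst_eqfun (lin c _ _ V0 Vu) _ => x; ring. Qed.

Lemma subspaceB V u v : subspace V -> V u -> V v -> V (fun x => u x - v x).
Proof. by move=> [_ lin] Vu Vv; apply: subst_eqfun (lin (- 1) _ _ Vu Vv) _ => x; ring. Qed.

Lemma subspace_sum V (I : Type) (r : seq I) (P : pred I) (F : I -> X -> Cplx) : subspace V ->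
  (forall i, P i -> V (F i)) -> V (fun x => \sum_(i <- r | P i) F i x).
Proof.
move=> sV VF; elim: r => [|i r IH].
  by apply: subst_eqfun (proj1 sV) _ => x; rewrite big_nil.
case Pi: (P i); last by apply: subst_eqfun IH _ => x; rewrite big_cons Pi.
by apply: subst_eqfun (subspaceD sV (VF i Pi) IH) _ => x; rewrite big_cons Pi.
Qed.

Lemma subspaceI V V' : subspace V -> subspace V' -> subspace (fun w => V w /\ V' w).
Proof. by move=> [? lin] [? lin']; split=> // c u v [? ?] [? ?]; split; auto. Qed.

Lemma in_span_subspace s : subspace (in_span s).
Proof.
elim: s => [|u s [span0 lin]]; first by split=> //= c u v u0 v0 x; rewrite u0 v0; ring.
split; first by exists 0; apply: subst_eqfun span0 _ => x; ring.
move=> c v w [a va] [b wb]; exists (a + c * b).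
by apply: subst_eqfun (lin c _ _ va wb) _ => x; ring.
Qed.
#[local] Hint Resolve in_span_subspace : core.

Lemma in_span_cons u s w : in_span s w -> in_span (u :: s) w.
Proof. by move=> sw; exists 0; apply: subst_eqfun sw _ => x; ring. Qed.

Lemma in_span_head u s : in_span (u :: s) u.
Proof. by exists 1; apply: subst_eqfun (proj1 (in_span_subspace s)) _ => x; ring. Qed.

Lemma in_span_catl s t w : in_span s w -> in_span (s ++ t) w.
Proof.
elim: s w => [|u s IH] w /=; last by case=> c sw; exists c; exact: IH.
by move=> w0; apply: subst_eqfun (proj1 (in_span_subspace t)) _ => x; rewrite w0.
Qed.

Lemma in_span_catr s t w : in_span t w -> in_span (s ++ t) w.
Proof. by elim: s => [//|u s IH] tw; apply: in_span_cons; exact: IH. Qed.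

Lemma in_span_flatten (I : eqType) (r : seq I) (S : I -> seq (X -> Cplx)) i w :
  i \in r -> in_span (S i) w -> in_span (flatten [seq S j | j <- r]) w.
Proof.
move=> + Siw; elim: r => [//|j r IH]; rewrite inE => /orP [/eqP <-|/IH]; last exact: in_span_catr.
exact: in_span_catl.
Qed.

Lemma mem_in_span s w : w \in s -> in_span s w.
Proof.
elim: s => [//|u s IH]; rewrite inE => /orP [/eqP ->|/IH]; last exact: in_span_cons.
exact: in_span_head.
Qed.

Lemma span_min V s w : subspace V -> (forall u, u \in s -> V u) -> in_span s w -> V w.
Proof.
move=> sV; elim: s w => [|u s IH] w Vs.
  by move=> w0; apply: subst_eqfun (proj1 sV) _ => x; rewrite w0.
move=> [c /IH Vw]; have {}Vw := Vw (fun v sv => Vs v (@mem_behead _ (u :: s) v sv)).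
by apply: subst_eqfun (proj2 sV c _ _ Vw (Vs u (mem_head u s))) _ => x; ring.
Qed.

Lemma in_span_eq0 s w x : in_span s w -> (forall u, u \in s -> u x = 0) -> w x = 0.
Proof.
move=> sw s0; apply: (span_min (V := fun w => w x = 0) _ s0 sw).
by split=> // c u v -> ->; ring.
Qed.

Lemma in_span_lincomb (I : Type) (r : seq I) (c : I -> Cplx) (F : I -> X -> Cplx) :
  in_span [seq F i | i <- r] (fun x => \sum_(i <- r) (c i * F i x)).
Proof.
elim: r => [|i r IH] /=; first by move=> x; rewrite big_nil.
by exists (c i); apply: subst_eqfun IH _ => x; rewrite big_cons; ring.
Qed.

Lemma in_span_iota (W : nat -> X -> Cplx) n w : in_span [seq W k | k <- iota 0 n] w ->
  exists c : nat -> Cplx, forall x, w x = \sum_(k < n) (c k * W k x).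
Proof.
elim: n W w => [|n IH] W w; first by move=> w0; exists (fun=> 0) => x; rewrite big_ord0.
rewrite /= -[1%N]addn0 iotaDl -map_comp => -[a /(IH (fun k => W k.+1)) [c cw]].
exists (fun k => if k is j.+1 then c j else a) => x.
by rewrite big_ord_recl /= -cw; ring.
Qed.

(* Gaussian elimination: if [W k0] involves the head of [s], subtract multiples of it from the
   later terms. *)
Lemma sequence_dependent s (W : nat -> X -> Cplx) : (forall k, in_span s (W k)) ->
  exists n, in_span [seq W k | k <- iota 0 n] (W n).
Proof.
elim: s W => [|u s IH] W sW; first by exists O => x; rewrite sW.
have [a Wa] := choice sW.
case: (pselect (forall k, a k = 0)) => [a0|/existsNP [k0 ak0]].
  by apply: IH => k; apply: subst_eqfun (Wa k) _ => x; rewrite a0; ring.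
pose b k := a (k0.+1 + k)%N / a k0.
pose W' k x := W (k0.+1 + k)%N x - b k * W k0 x.
have [|n W'n] := IH W'.
  move=> k; have Wk := Wa (k0.+1 + k)%N.
  apply: subst_eqfun (subspaceB (in_span_subspace s) Wk (subspaceZ (b k) _ (Wa k0))) _ => // x.
  by rewrite /W' /b; field.
exists (k0.+1 + n)%N; set L := map _ _.
have LW k : (k < k0.+1 + n)%N -> in_span L (W k).
  by move=> kn; apply: mem_in_span; apply: map_f; rewrite mem_iota.
have W'L : in_span L (W' n).
  apply: span_min W'n => // _ /mapP [k + ->]; rewrite mem_iota => /= kn.
  apply: (subspaceB (in_span_subspace L)); first by apply: LW; rewrite ltn_add2l.
  by apply: (subspaceZ _ (in_span_subspace L)); apply: LW; rewrite ltn_addr.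
have LWk0 := LW k0 (ltn_addr n (ltnSn k0)).
by apply: subst_eqfun (proj2 (in_span_subspace L) (b n) _ _ W'L LWk0) _ => x; rewrite /W'; ring.
Qed.

End Span.

Section Interpolation.
Variable X : Type.
Local Open Scope cplx_scope.
Implicit Types (u v w : X -> Cplx) (l : seq (X * (X -> Cplx))) (V : (X -> Cplx) -> Prop).

Definition interpolate l w : X -> Cplx := fun x => \sum_(p <- l) (w p.1 * p.2 x).

Definition reproduces V l :=
  (forall v, v \in unzip2 l -> V v) /\ forall w, V w -> w =1 interpolate l w.

Lemma interpolate_lin l c u v x :
  interpolate l (fun y => u y + c * v y) x = interpolate l u x + c * interpolate l v x.
Proof. by rewrite /interpolate -Csum_lin; apply: eq_bigr => p _; ring. Qed.

Lemma interpolate_in V l w :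
  subspace V -> (forall v, v \in unzip2 l -> V v) -> V (interpolate l w).
Proof.
move=> sV; elim: l => [|p l IH] Vl.
  by apply: subst_eqfun (proj1 sV) _ => x; rewrite /interpolate big_nil.
have Vpl := IH (fun v lv => Vl v (@mem_behead _ (p.2 :: unzip2 l) v lv)).
apply: subst_eqfun (proj2 sV (w p.1) _ _ Vpl (Vl p.2 (mem_head _ _))) _ => x.
by rewrite /interpolate big_cons; ring.
Qed.

Lemma reproduces_adjoin V V' l w1 x0 : subspace V -> (forall w, V' w -> V w) -> reproduces V' l ->
  V w1 -> w1 x0 <> 0 -> interpolate l w1 =1 (fun=> 0) ->
  (forall w, V w -> exists a, V' (fun x => w x + a * w1 x)) ->
  exists l', reproduces V l'.
Proof.
move=> sV V'V [V'l repr] Vw1 w1x0 lw1 decomp.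
pose v0 x := w1 x / w1 x0.
have Vv0 : V v0 by apply: subst_eqfun (subspaceZ (/ w1 x0) sV Vw1) _ => x; rewrite /v0; field.
pose reduce v x := v x - v x0 * v0 x.
exists ((x0, v0) :: [seq (p.1, reduce p.2) | p <- l]); split.
  move=> v; rewrite /unzip2 /= -map_comp (map_comp reduce snd) inE.
  move=> /orP [/eqP -> //|/mapP [u lu ->]].
  by apply: subspaceB => //; [exact/V'V/V'l | exact: subspaceZ].
move=> w /[dup] Vw /decomp [a V'w] x.
have lw y : interpolate l w y = w y + a * w1 y.
  by have := repr _ V'w y; rewrite interpolate_lin lw1 => ->; ring.
rewrite /interpolate big_cons big_map /=.
rewrite (eq_bigr (fun p => w p.1 * p.2 x + - v0 x * (w p.1 * p.2 x0))); last first.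
  by move=> p _; rewrite /reduce; ring.
by rewrite Csum_lin -!/(interpolate l w _) !lw /v0; field.
Qed.

Lemma reproducing_points V s : subspace V -> (forall w, V w -> in_span s w) ->
  exists l, reproduces V l.
Proof.
elim: s V => [|u s IH] V sV Vs.
  by exists [::]; split=> // w /Vs w0 x; rewrite w0 /interpolate big_nil.
have [l repr] := IH _ (subspaceI sV (in_span_subspace s)) (fun w => @proj2 _ _).
case: (pselect (forall w, V w -> in_span s w)) => [sub_s|/existsNP [w0 /not_implyP [Vw0 Nsw0]]].
  by exists l; split=> [v /(proj1 repr) []|w Vw] //; apply: (proj2 repr); split=> //; exact: sub_s.
pose w1 x := w0 x + - 1 * interpolate l w0 x.
have [Vlw0 slw0] : V (interpolate l w0) /\ in_span s (interpolate l w0).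
  by split; apply: interpolate_in => [|v /(proj1 repr) []] //; exact: in_span_subspace.
have [c0 sw0] := Vs _ Vw0.
have c0_neq0 : c0 <> 0.
  by move=> c00; apply: Nsw0; apply: subst_eqfun sw0 _ => x; rewrite c00; ring.
have [x0 w1x0] : exists x0, w1 x0 <> 0.
  apply/existsNP => w10; apply: Nsw0; apply: subst_eqfun slw0 _ => x; apply: esym.
  by apply: Csub_eq0; rewrite -[RHS](w10 x) /w1; ring.
apply: (reproduces_adjoin sV _ repr _ w1x0) => [w []//| |x|w Vw].
- exact: (proj2 sV).
- by rewrite interpolate_lin -(proj2 repr _ (conj Vlw0 slw0)); ring.
have [c sw] := Vs _ Vw; exists (- (c / c0)); split.
  by apply: (proj2 sV) => //; exact: (proj2 sV).
have [_ lin] := in_span_subspace s.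
apply: subst_eqfun (lin (c / c0) _ _ (lin (- (c / c0)) _ _ sw sw0) slw0) _ => x.
by rewrite /w1; field.
Qed.

(* [X] is regarded as a vector space of which only the linear combinations are given. *)
Section CommonKernel.
Variable lincomb : seq (Cplx * X) -> X.

Definition linear_functional w := forall r, w (lincomb r) = \sum_(p <- r) (p.1 * w p.2).

Lemma in_span_of_common_kernel s w : (forall u, u \in s -> linear_functional u) ->
  linear_functional w -> (forall x, (forall u, u \in s -> u x = 0) -> w x = 0) -> in_span s w.
Proof.
move=> lin_s lin_w ker.
have [l [sl repr]] := reproducing_points (in_span_subspace s) (fun w sw => sw).
pose residue x := lincomb ((1, x) :: [seq (- p.2 x, p.1) | p <- l]).
have residueE u x : linear_functional u -> u (residue x) = u x - interpolate l u x.
  move=> lin_u; rewrite lin_u big_cons big_map /=.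
  rewrite (eq_bigr (fun p => - 1 * (u p.1 * p.2 x))); last by move=> p _ /=; ring.
  by rewrite -Cmul_sumr /interpolate; ring.
apply: subst_eqfun (interpolate_in w (in_span_subspace s) sl) _ => x.
apply/esym/Csub_eq0; rewrite -residueE //; apply: ker => u su.
by rewrite (residueE _ _ (lin_s u su)) -(repr u (mem_in_span su)); ring.
Qed.

End CommonKernel.
End Interpolation.

Section FiniteRank.
Local Open Scope cplx_scope.
Variables (X I : Type).

Definition finite_rank (F : I -> X -> Cplx) := exists s, forall i, in_span s (F i).

Lemma finite_rank_interpolate (F : I -> X -> Cplx) :
  finite_rank F -> exists l, forall i, F i =1 interpolate l (F i).
Proof.
move=> [s sF]; have [l [_ repr]] := reproducing_points (in_span_subspace s) (fun w sw => sw).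
by exists l => i; apply: repr.
Qed.

Lemma interpolate_finite_rank (F : I -> X -> Cplx) l :
  (forall i, F i =1 interpolate l (F i)) -> finite_rank F.
Proof.
move=> repr; exists (unzip2 l) => i; apply: subst_eqfun (fsym (repr i)).
by apply: interpolate_in; [exact: in_span_subspace | exact: mem_in_span].
Qed.

Lemma finite_rank_family (T : finType) (F : T -> I -> X -> Cplx) :
  (forall k, finite_rank (F k)) -> exists s, forall k i, in_span s (F k i).
Proof.
move=> /choice [S SF]; exists (flatten [seq S k | k <- enum T]) => k i.
by apply: in_span_flatten (SF k i); rewrite mem_enum.
Qed.

End FiniteRank.

Section LinearImages.
Local Open Scope cplx_scope.
Variables X Y : Type.

Lemma in_span_map (V : (X -> Cplx) -> Prop) (L : (X -> Cplx) -> Y -> Cplx) s w : subspace V ->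
  (forall c u v, V u -> V v -> L (fun x => u x + c * v x) =1 fun y => L u y + c * L v y) ->
  (forall u, u \in s -> V u) -> V w -> in_span s w -> in_span [seq L u | u <- s] (L w).
Proof.
move=> sV linL; elim: s w => [|u s IH] w Vs Vw /=.
  move=> /funext w0 y; rewrite (_ : w = fun x => w x + - 1 * w x) ?linL //; first by ring.
  by rewrite w0; apply: funext => x; ring.
have Vu := Vs u (mem_head u s).
move=> [c sw]; exists c.
have {}sw : in_span s (fun x => w x + - c * u x) by apply: subst_eqfun sw _ => x; ring.
apply: subst_eqfun (IH _ _ _ sw) _ => [v sv||y]; last by rewrite linL //; ring.
  by apply: Vs; rewrite inE sv orbT.
exact: (proj2 sV).
Qed.

Lemma in_span_comp (phi : Y -> X) s w :
  in_span s w -> in_span [seq (fun y => u (phi y)) | u <- s] (fun y => w (phi y)).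
Proof. exact: (@in_span_map (fun=> True) (fun u y => u (phi y))). Qed.

End LinearImages.

Section Products.
Local Open Scope cplx_scope.
Variable X : Type.

Lemma in_span_mul s t (u v : X -> Cplx) : in_span s u -> in_span t v ->
  in_span [seq (fun x => p x * q x) | p <- s, q <- t] (fun x => u x * v x).
Proof.
move=> su tv; set st := [seq _ | p <- s, q <- t].
have subst := in_span_subspace st.
have sv : in_span [seq (fun x => p x * v x) | p <- s] (fun x => u x * v x).
  by apply: (@in_span_map _ _ (fun=> True) (fun p x => p x * v x)) su => // c f g _ _ x; ring.
apply: span_min sv => // _ /mapP [p sp ->].
have tpv : in_span [seq (fun x => p x * q x) | q <- t] (fun x => p x * v x).
  by apply: (@in_span_map _ _ (fun=> True) (fun q x => p x * q x)) tv => // c f g _ _ x; ring.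
by apply: span_min tpv => // _ /mapP [q tq ->]; apply: mem_in_span; exact: allpairs_f.
Qed.

End Products.

Section Recurrences.
Local Open Scope cplx_scope.
Variables (X : Type) (V : (X -> Cplx) -> Prop).
Hypothesis sV : subspace V.

Lemma subspace_solve n (c : 'I_n -> Cplx) (b : 'I_n -> X -> Cplx) j0 : c j0 <> 0 ->
  V (fun x => \sum_(j < n) (c j * b j x)) -> (forall j, j != j0 -> V (b j)) -> V (b j0).
Proof.
move=> cj0 Vsum Vb.
have Vrest : V (fun x => \sum_(j <- index_enum 'I_n | j != j0) (c j * b j x)).
  by apply: subspace_sum => // j /Vb; exact: subspaceZ.
apply: subst_eqfun (subspaceZ (/ c j0) sV (subspaceB sV Vsum Vrest)) _ => x.
by rewrite (bigD1 j0) //=; set rest := bigop _ _ _; field.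
Qed.

Variables (m : nat) (c : nat -> Cplx) (b : Z -> X -> Cplx).
Hypotheses (c0 : c 0%N <> 0) (cm : c m <> 0).
Hypothesis recurrence : forall q, V (fun x => \sum_(j < m.+1) (c j * b (q + Z.of_nat j)%Z x)).

Let window q := forall j, (j < m)%N -> V (b (q + Z.of_nat j)%Z).

Let next_term q : window q -> V (b (q + Z.of_nat m)%Z).
Proof.
move=> win; apply: (subspace_solve (j0 := ord_max) _ (recurrence q)) => // j jm.
by apply: win; rewrite ltn_neqAle -ltnS ltn_ord andbT.
Qed.

Let previous_term q : window (Z.succ q) -> V (b q).
Proof.
move=> win; have := subspace_solve (j0 := ord0) _ (recurrence q); rewrite Z.add_0_r; apply=> // j.
rewrite -(inj_eq val_inj) -lt0n /= => j0.
have -> : (q + Z.of_nat j = Z.succ q + Z.of_nat j.-1)%Z.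
  by move: j0; case: (nat_of_ord j) => // k _; rewrite Nat2Z.inj_succ /=; lia.
by apply: win; rewrite -ltnS prednK.
Qed.

Lemma two_sided_recurrence : (forall j, (j < m)%N -> V (b (Z.of_nat j))) -> forall q, V (b q).
Proof.
move=> init; suff win q : window q.
  move=> q; have -> : (q = q - Z.of_nat m + Z.of_nat m)%Z by lia.
  exact: next_term.
apply: (Z.bi_induction window) => {q} [j jm|q]; first by rewrite Z.add_0_l; exact: init.
split=> win j jm.
  have -> : (Z.succ q + Z.of_nat j = q + Z.of_nat j.+1)%Z by rewrite Nat2Z.inj_succ; lia.
  by move: jm; rewrite leq_eqVlt => /orP [/eqP ->|/win //]; exact: next_term.
case: j jm => [|j] jm; first by rewrite Z.add_0_r; exact: previous_term.
have -> : (q + Z.of_nat j.+1 = Z.succ q + Z.of_nat j)%Z by rewrite Nat2Z.inj_succ; lia.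
exact/win/ltnW.
Qed.

End Recurrences.

Section Translates.
Local Open Scope cplx_scope.
Variables (G : Type) (add : G -> G -> G).
Hypothesis addA : associative add.
Implicit Types (f w : G -> Cplx) (V : (G -> Cplx) -> Prop).

Definition translates_span f w := exists r : seq (Cplx * G),
  w =1 fun x => \sum_(p <- r) (p.1 * f (add x p.2)).

Lemma translates_span_subspace f : subspace (translates_span f).
Proof.
split; first by exists [::] => x; rewrite big_nil.
move=> c u v [r ur] [r' vr']; exists (r ++ [seq (c * p.1, p.2) | p <- r']) => x.
rewrite big_cat big_map ur vr' Cmul_sumr /=; congr Cadd.
by apply: eq_bigr => p _; ring.
Qed.

Lemma translates_span_min f V w : subspace V -> (forall y, V (fun x => f (add x y))) ->
  translates_span f w -> V w.
Proof.
move=> sV Vf [r /fsym rw]; apply: subst_eqfun rw.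
by apply: (subspace_sum _ (F := fun p x => p.1 * f (add x p.2))) => // p _; exact: subspaceZ.
Qed.

Lemma translates_span_gen f y : translates_span f (fun x => f (add x y)).
Proof. by exists [:: (1, y)] => x; rewrite big_cons big_nil /=; ring. Qed.

Lemma translates_span_stable f w y :
  translates_span f w -> translates_span f (fun x => w (add x y)).
Proof.
move=> [r wr]; exists [seq (p.1, add y p.2) | p <- r] => x.
by rewrite wr big_map; apply: eq_bigr => p _; rewrite addA.
Qed.

End Translates.

Section LinearFactor.
Import ssralg poly complex GRing.Theory.
Local Open Scope cplx_scope.

Let to_complex (z : Cplx) : complex R := Complex (fst z) (snd z).
Let of_complex (z : complex R) : Cplx := (Re z, Im z).

Let of_complexB (z w : complex R) : of_complex (z - w)%R = of_complex z - of_complex w.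
Proof. by case: z; case: w. Qed.
Let of_complexM (z w : complex R) : of_complex (z * w)%R = of_complex z * of_complex w.
Proof. by case: z; case: w. Qed.
Let to_complexK : cancel to_complex of_complex.
Proof. by case. Qed.

Lemma monic_linear_factor n (a : nat -> Cplx) : a n.+1 = 1 ->
  exists (lam : Cplx) (b : nat -> Cplx), b n = 1 /\ b n.+1 = 0 /\
    a 0%N = - (lam * b 0%N) /\ forall k, (k <= n)%N -> a k.+1 = b k - lam * b k.+1.
Proof.
move=> an; pose p : {poly complex R} := (\poly_(k < n.+2) to_complex (a k))%R.
have sizep : size p = n.+2 by apply: size_poly_eq; rewrite /= an; exact: oner_neq0.
have [lam /factor_theorem [q pE]] : exists lam, root p lam.
  by apply/closed_rootP; rewrite sizep.
have sizeq : size q = n.+1.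
  have q_neq0 : q != 0%R.
    by apply: contra_eq_neq pE => ->; rewrite mul0r -size_poly_eq0 sizep.
  by move: sizep; rewrite pE size_Mmonic ?monicXsubC // size_XsubC addn2 => -[].
have coef0 : to_complex (a 0%N) = (0 - lam * q`_0)%R.
  have /= := congr1 (fun r : {poly _} => r`_0)%R pE.
  by rewrite coef_poly mulrBr coefB coefMX coefMC mulrC.
have coefS k : (k <= n)%N -> to_complex (a k.+1) = (q`_k - lam * q`_k.+1)%R.
  move=> kn; have /= := congr1 (fun r : {poly _} => r`_k.+1)%R pE.
  by rewrite coef_poly !ltnS kn mulrBr coefB coefMX coefMC mulrC.
have qSn : (q`_n.+1 = 0)%R by apply: nth_default; rewrite sizeq.
exists (of_complex lam), (fun k => of_complex (q`_k)%R); split; last split; last split.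
- by have := coefS n (leqnn n); rewrite qSn mulr0 subr0 => <-; rewrite to_complexK.
- by rewrite qSn.
- by rewrite -(to_complexK (a 0%N)) coef0 of_complexB of_complexM (_ : of_complex 0%R = 0) //; ring.
- by move=> k kn; rewrite -(to_complexK (a k.+1)) coefS // of_complexB of_complexM.
Qed.

End LinearFactor.

(** * Functions of one real variable *)

Definition cderiv (f : R -> Cplx) (t : R) (l : Cplx) : Prop :=
  derivable_pt_lim (fun s => fst (f s)) t (fst l) /\
  derivable_pt_lim (fun s => snd (f s)) t (snd l).
Arguments cderiv f t%_R l%_C.

Lemma cderiv_ext f g t l l' : cderiv f t l -> f =1 g -> l = l' -> cderiv g t l'.
Proof. by move=> df /funext <- <-. Qed.

Lemma cderiv_unique f t l l' : cderiv f t l -> cderiv f t l' -> l = l'.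
Proof.
case: l l' => [a b] [a' b'] [/= fa fb] [/= fa' fb'].
by rewrite (uniqueness_limite _ _ _ _ fa fa') (uniqueness_limite _ _ _ _ fb fb').
Qed.

Lemma cderiv_const z t : cderiv (fun=> z) t 0.
Proof. by split; exact: derivable_pt_lim_const. Qed.

Lemma cderivD f g t a b :
  cderiv f t a -> cderiv g t b -> cderiv (fun s => f s + g s)%C t (a + b).
Proof. by move=> [? ?] [? ?]; split; apply: derivable_pt_lim_plus. Qed.

Lemma cderivM f g t a b : cderiv f t a -> cderiv g t b ->
  cderiv (fun s => f s * g s)%C t (a * g t + f t * b).
Proof.
move=> [f1 f2] [g1 g2]; split=> /=.
  have := derivable_pt_lim_minus _ _ _ _ _
    (derivable_pt_lim_mult _ _ _ _ _ f1 g1) (derivable_pt_lim_mult _ _ _ _ _ f2 g2).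
  by congr derivable_pt_lim; ring.
have := derivable_pt_lim_plus _ _ _ _ _
  (derivable_pt_lim_mult _ _ _ _ _ f1 g2) (derivable_pt_lim_mult _ _ _ _ _ f2 g1).
by congr derivable_pt_lim; ring.
Qed.

Lemma cderivZ z f t a : cderiv f t a -> cderiv (fun s => z * f s)%C t (z * a).
Proof. by move=> df; apply: cderiv_ext (cderivM (cderiv_const z t) df) _ _ => //; ring. Qed.

Lemma cderivB f g t a b :
  cderiv f t a -> cderiv g t b -> cderiv (fun s => f s - g s)%C t (a - b).
Proof. by move=> [? ?] [? ?]; split; apply: derivable_pt_lim_minus. Qed.

Lemma cderiv_sum (I : Type) (r : seq I) (F : I -> R -> Cplx) t (L : I -> Cplx) :
  (forall i, cderiv (F i) t (L i)) ->
  cderiv (fun s => \sum_(i <- r) F i s)%C t (\sum_(i <- r) L i).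
Proof.
move=> dF; elim: r => [|i r IH].
  by apply: cderiv_ext (cderiv_const 0 t) _ _ => [s|]; rewrite big_nil.
by apply: cderiv_ext (cderivD (dF i) IH) _ _ => [s|]; rewrite big_cons.
Qed.

Lemma cderiv_RtoC f t l : derivable_pt_lim f t l -> cderiv (fun s => (f s)%:C) t l%:C.
Proof. by move=> df; split=> //; exact: derivable_pt_lim_const. Qed.

Lemma derivable_pt_lim_affine a b t : derivable_pt_lim (fun s => a * s + b) t a.
Proof.
have := derivable_pt_lim_plus _ _ _ _ _
  (derivable_pt_lim_scal _ a t _ (derivable_pt_lim_id t)) (derivable_pt_lim_const b t).
by rewrite Rmult_1_r Rplus_0_r.
Qed.

Lemma cderiv_affine f a b t l :
  cderiv f (a * t + b) l -> cderiv (fun s => f (a * s + b)) t (a%:C * l).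
Proof.
have daff := derivable_pt_lim_affine a b t.
move=> [df1 df2]; split=> /=.
  have := derivable_pt_lim_comp _ _ _ _ _ daff df1.
  by congr derivable_pt_lim; ring.
have := derivable_pt_lim_comp _ _ _ _ _ daff df2.
by congr derivable_pt_lim; ring.
Qed.

Lemma cderiv_shift f b t l : cderiv f (t + b) l -> cderiv (fun s => f (s + b)) t l.
Proof.
rewrite -{1}(Rmult_1_l t) => /cderiv_affine df.
by apply: cderiv_ext df _ _ => [s|]; [rewrite Rmult_1_l | ring].
Qed.

Lemma cderiv0_const f : (forall t, cderiv f t 0) -> forall t, f t = f 0.
Proof.
move=> df t; rewrite [LHS]surjective_pairing [RHS]surjective_pairing.
have constant (g : R -> R) : (forall s, derivable_pt_lim g s 0) -> g t = g 0.
  move=> dg; have pr : derivable g by move=> s; exists 0; exact: dg.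
  by apply: (null_derivative_1 g pr) => s; apply: derive_pt_eq_0; exact: dg.
by congr pair; apply: (constant (fun s => _ (f s))) => s; case: (df s).
Qed.

Definition ccont1 (f : R -> Cplx) := forall t,
  continuity_pt (fun s => fst (f s)) t /\ continuity_pt (fun s => snd (f s)) t.

Lemma primitive_exists f : ccont1 f -> exists F, forall t, cderiv F t (f t).
Proof.
move=> cf; exists (fun t => (RInt (fun s => fst (f s)) 0 t, RInt (fun s => snd (f s)) 0 t)) => t.
have primitive (g : R -> R) : (forall s, continuity_pt g s) ->
    derivable_pt_lim (fun s => RInt g 0 s) t (g t).
  move=> cg; apply/is_derive_Reals.
  have cont s : continuous g s by apply/continuity_pt_filterlim.
  apply: is_derive_RInt (cont t).
  by exists (mkposreal 1 Rlt_0_1) => s _; apply/RInt_correct/ex_RInt_continuous.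
by split; apply: primitive => s; case: (cf s).
Qed.

Section ExpPoly1.
Local Open Scope cplx_scope.

Definition expc (mu : Cplx) (t : R) : Cplx := Cexp (mu * t%:C).
Definition exp_monom (k : nat) (mu : Cplx) (t : R) : Cplx := (t ^ k)%:C * expc mu t.

Inductive exp_poly1 : (R -> Cplx) -> Prop :=
| exp_poly1_monom k mu : exp_poly1 (exp_monom k mu)
| exp_poly1_lin c f g : exp_poly1 f -> exp_poly1 g -> exp_poly1 (fun t => f t + c * g t).

Lemma exp_poly1_subspace : subspace exp_poly1.
Proof.
split; last exact: exp_poly1_lin.
have mono := exp_poly1_monom 0 0.
by apply: subst_eqfun (exp_poly1_lin (- 1) mono mono) _ => t; ring.
Qed.

Lemma expc0 t : expc 0 t = 1.
Proof. by rewrite /expc Cmul0z Cexp0. Qed.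

Lemma expcD mu nu t : expc (mu + nu) t = expc mu t * expc nu t.
Proof. by rewrite /expc CmulDl CexpD. Qed.

Lemma expcN mu t : expc mu t * expc (- mu) t = 1.
Proof. by rewrite -expcD -(expc0 t); congr expc; ring. Qed.

Lemma exp_poly1_const c : exp_poly1 (fun=> c).
Proof.
apply: subst_eqfun (subspaceZ c exp_poly1_subspace (exp_poly1_monom 0 0)) _ => t.
by rewrite /exp_monom expc0 /=; ring.
Qed.

Lemma exp_poly1_expcM nu f : exp_poly1 f -> exp_poly1 (fun t => expc nu t * f t).
Proof.
elim=> [k mu|c g h _ IHg _ IHh].
  by apply: subst_eqfun (exp_poly1_monom k (nu + mu)) _ => t; rewrite /exp_monom expcD; ring.
by apply: subst_eqfun (exp_poly1_lin c IHg IHh) _ => t; ring.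
Qed.

Lemma cderiv_expc mu t : cderiv (expc mu) t (mu * expc mu t).
Proof.
pose cis s : Cplx := (cos (snd mu * s), sin (snd mu * s)).
have expcE s : expc mu s = (exp (fst mu * s))%:C * cis s.
  rewrite /expc /cis /Cexp /Cmul /RtoC /=; congr pair; rewrite !Rmult_0_r !Rmult_0_l;
  by rewrite ?Rplus_0_l ?Rminus_0_r ?Rplus_0_r.
have lin a : derivable_pt_lim (fun s => a * s)%R t a.
  by have := derivable_pt_lim_scal _ a t _ (derivable_pt_lim_id t); rewrite Rmult_1_r.
have dexp : cderiv (fun s => (exp (fst mu * s))%:C) t (exp (fst mu * t) * fst mu)%R%:C.
  by apply/cderiv_RtoC/(derivable_pt_lim_comp _ _ _ _ _ (lin _))/derivable_pt_lim_exp.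
have dcis : cderiv cis t (- sin (snd mu * t) * snd mu, cos (snd mu * t) * snd mu)%R.
  split; [exact: (derivable_pt_lim_comp _ _ _ _ _ (lin _) (derivable_pt_lim_cos _)) |
          exact: (derivable_pt_lim_comp _ _ _ _ _ (lin _) (derivable_pt_lim_sin _))].
apply: cderiv_ext (cderivM dexp dcis) (fsym expcE) _.
by rewrite expcE /cis /Cadd /Cmul /RtoC /=; congr pair; ring.
Qed.

Lemma cderiv_exp_monom k mu t :
  cderiv (exp_monom k.+1 mu) t ((INR k.+1)%:C * exp_monom k mu t + mu * exp_monom k.+1 mu t).
Proof.
have dpow := cderiv_RtoC (derivable_pt_lim_pow t k.+1).
by apply: cderiv_ext (cderivM dpow (cderiv_expc mu t)) _ _ => //; rewrite /exp_monom RtoCM /=; ring.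
Qed.

Lemma exp_monom_primitive k mu :
  exists F, exp_poly1 F /\ forall t, cderiv F t (exp_monom k mu t).
Proof.
have sp := exp_poly1_subspace.
case: (eqVneq mu 0) => [->|/eqP mu0].
  have k0 : (INR k.+1)%:C <> 0 by move/RtoC_inj; exact: not_0_INR.
  exists (fun t => / (INR k.+1)%:C * exp_monom k.+1 0 t); split.
    by apply: (subspaceZ _ sp); exact: exp_poly1_monom.
  by move=> t; apply: cderiv_ext (cderivZ _ (cderiv_exp_monom k 0 t)) _ _ => //; field.
elim: k => [|k [F [EF dF]]].
  exists (fun t => / mu * exp_monom 0 mu t); split.
    by apply: (subspaceZ _ sp); exact: exp_poly1_monom.
  move=> t; apply: cderiv_ext (cderivZ (/ mu) (cderiv_expc mu t)) _ _ => [s|].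
    by rewrite /exp_monom /=; ring.
  by rewrite /exp_monom /=; field.
exists (fun t => / mu * (exp_monom k.+1 mu t - (INR k.+1)%:C * F t)); split.
  by apply/(subspaceZ _ sp)/(subspaceB sp); [exact: exp_poly1_monom | exact: subspaceZ].
move=> t; have dmono := cderiv_exp_monom k mu t.
by apply: cderiv_ext (cderivZ _ (cderivB dmono (cderivZ _ (dF t)))) _ _ => //; field.
Qed.

Lemma exp_poly1_primitive f : exp_poly1 f ->
  exists F, exp_poly1 F /\ forall t, cderiv F t (f t).
Proof.
elim=> [k mu|c g h _ [G [EG dG]] _ [H [EH dH]]]; first exact: exp_monom_primitive.
exists (fun t => G t + c * H t); split; first exact: exp_poly1_lin.
by move=> t; apply: cderivD => //; exact: cderivZ.
Qed.

Lemma exp_poly1_first_order_ode lam w u : exp_poly1 u ->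
  (forall t, cderiv w t (u t + lam * w t)) -> exp_poly1 w.
Proof.
move=> Eu dw; have sp := exp_poly1_subspace.
have [F [EF dF]] := exp_poly1_primitive (exp_poly1_expcM (- lam) Eu).
pose H t := expc (- lam) t * w t - F t.
have dH t : cderiv H t 0.
  apply: cderiv_ext (cderivB (cderivM (cderiv_expc _ t) (dw t)) (dF t)) _ _ => //.
  by ring.
have Econst := subspaceD sp EF (exp_poly1_const (H 0%R)).
apply: subst_eqfun (exp_poly1_expcM lam Econst) _ => t.
rewrite -(cderiv0_const dH t) /H -[RHS]Cmul1z -(expcN lam t).
by ring.
Qed.

Lemma exp_poly1_linear_ode n (a : nat -> Cplx) (W : nat -> R -> Cplx) : a n = 1 ->
  (forall k t, cderiv (W k) t (W k.+1 t)) -> (forall t, \sum_(k < n.+1) (a k * W k t) = 0) ->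
  exp_poly1 (W 0%N).
Proof.
elim: n a W => [|n IH] a W an dW ode.
  apply: subst_eqfun (proj1 exp_poly1_subspace) _ => t.
  by rewrite -(ode t) big_ord1 /= an; ring.
have [lam [b [bn [bSn [a0 aS]]]]] := monic_linear_factor an.
pose U k t := W k.+1 t - lam * W k t.
apply: (@exp_poly1_first_order_ode lam _ (U 0%N)); last first.
  by move=> t; apply: cderiv_ext (dW 0%N t) _ _ => //; rewrite /U; ring.
apply: (IH b) => // [k t|t]; first by apply: cderivB => //; exact: cderivZ.
have sum_bW : \sum_(k < n.+1) (b k * W k t) = b 0%N * W 0%N t + \sum_(k < n.+1) (b k.+1 * W k.+1 t).
  rewrite -(big_ord_recl n.+1 (fun k => b k * W k t)) [RHS]big_ord_recr /= bSn; ring.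
rewrite -[RHS](ode t) [in RHS]big_ord_recl a0.
rewrite (eq_bigr (fun k : 'I_n.+1 => b k * W k.+1 t + - lam * (b k * W k t))); last first.
  by move=> k _; rewrite /U; ring.
pose G k := b k * W k.+1 t + - lam * (b k.+1 * W k.+1 t).
rewrite [in RHS](eq_bigr (fun k : 'I_n.+1 => G k)); last first.
  by move=> k _; rewrite /G lift0 (aS k (leq_ord k)); ring.
by rewrite !Csum_lin sum_bW /=; ring.
Qed.

End ExpPoly1.

Section Differentiation.
Local Open Scope cplx_scope.
Variable X : Type.

Lemma cderiv_interpolate l (F : R -> X -> Cplx) s (g : X -> Cplx) x :
  (forall y, cderiv (F^~ y) s (g y)) ->
  cderiv (fun u => interpolate l (F u) x) s (interpolate l g x).
Proof.
move=> dF; apply: (cderiv_sum _ (F := fun p u => F u p.1 * p.2 x) (L := fun p => _ * p.2 x)) => p.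
by apply: cderiv_ext (cderivZ (p.2 x) (dF p.1)) _ _ => [u|]; ring.
Qed.

Lemma interpolate_primitive l (F f : R -> X -> Cplx) :
  (forall s x, cderiv (F^~ x) s (f s x)) -> F 0%R =1 (fun=> 0) ->
  (forall s, f s =1 interpolate l (f s)) -> forall s, F s =1 interpolate l (F s).
Proof.
move=> dF F0 repr s x; apply: Csub_eq0.
rewrite (@cderiv0_const (fun u => F u x - interpolate l (F u) x)); last first.
  move=> t; have dl := cderiv_interpolate l x (dF t).
  by apply: cderiv_ext (cderivB (dF t x) dl) _ _ => //; rewrite -repr; ring.
rewrite F0 /interpolate big1 => [|p _]; first by ring.
by rewrite F0; ring.
Qed.

Lemma interpolate_cderiv l (F : R -> X -> Cplx) (g : X -> Cplx) :
  (forall x, cderiv (F^~ x) 0 (g x)) -> (forall s, F s =1 interpolate l (F s)) ->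
  g =1 interpolate l g.
Proof.
move=> dF repr x; apply: cderiv_unique (dF x) _.
by apply: cderiv_ext (cderiv_interpolate l x dF) _ _ => // s; rewrite -repr.
Qed.

Definition derivable_in (V : (R -> Cplx) -> Prop) w :=
  V w /\ exists w', V w' /\ forall t, cderiv w t (w' t).

Lemma derivable_in_subspace V : subspace V -> subspace (derivable_in V).
Proof.
move=> [V0 lin]; split.
  by split=> //; exists (fun=> 0); split=> // t; exact: cderiv_const.
move=> c u v [Vu [u' [Vu' du]]] [Vv [v' [Vv' dv]]]; split; first exact: lin.
exists (fun t => u' t + c * v' t); split; first exact: lin.
by move=> t; apply: cderivD => //; exact: cderivZ.
Qed.

End Differentiation.

Section FiniteRankTranslates1.
Local Open Scope cplx_scope.
Variable g : R -> Cplx.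
Hypotheses (cont_g : ccont1 g) (rank_g : finite_rank (fun s t => g (t + s)%R)).

Let V := translates_span Rplus g.

Let sV : subspace V := translates_span_subspace Rplus g.

Let RplusA : associative Rplus.
Proof. by move=> *; rewrite Rplus_assoc. Qed.

Let V_finite : exists s, forall w, V w -> in_span s w.
Proof.
have [s gs] := rank_g; exists s => w.
by apply: translates_span_min => //; exact: in_span_subspace.
Qed.

(* The averages of translates of [g] are differentiable, and their derivatives lie in [V]. The
   functions with this property form a finite-dimensional space, which is closed under the limit
   that recovers [g]. *)
Lemma derivable_in_translates_span : derivable_in V g.
Proof.
have [s Vs] := V_finite.
have [G dG] := primitive_exists cont_g.
have [l [Vl repr]] := reproducing_points sV Vs.
have sV1 := derivable_in_subspace sV.
have [l1 [V1l1 repr1]] := reproducing_points sV1 (fun w V1w => Vs w (proj1 V1w)).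
have Vg y : V (fun t => g (t + y)%R) by exact: translates_span_gen.
pose A y t := G (t + y)%R - G t.
have dA y t : cderiv (A^~ t) y (g (t + y)%R).
  have dGt : cderiv (fun u => G (u + t)%R) y (g (y + t)%R) by exact/cderiv_shift/dG.
  apply: cderiv_ext (cderivB dGt (cderiv_const (G t) y)) _ _ => [u|]; first by rewrite Rplus_comm.
  by rewrite Rplus_comm; ring.
have V1A y : derivable_in V (A y).
  split.
    apply: subst_eqfun (interpolate_in (A y) sV Vl) _; apply: fsym.
    apply: (interpolate_primitive dA) => [t|u]; first by rewrite /A Rplus_0_r; ring.
    exact: repr.
  exists (fun t => g (t + y)%R - g t); split.
    apply: (subspaceB sV) => //.
    by apply: subst_eqfun (Vg 0%R) _ => t; rewrite Rplus_0_r.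
  by move=> t; apply: cderivB => //; exact: cderiv_shift.
apply: subst_eqfun (interpolate_in g sV1 V1l1) (fsym _).
apply: (@interpolate_cderiv _ _ A) => [t|y]; last exact: repr1.
by apply: cderiv_ext (dA 0%R t) _ _ => //; rewrite Rplus_0_r.
Qed.

Lemma finite_rank_exp_poly1 : exp_poly1 g.
Proof.
have [Vg [g' [Vg' dg]]] := derivable_in_translates_span.
have derivable w : V w -> derivable_in V w.
  apply: translates_span_min => [|y]; first exact: derivable_in_subspace.
  split; first exact: translates_span_gen.
  exists (fun t => g' (t + y)%R); split; first exact: (translates_span_stable RplusA).
  by move=> t; exact: cderiv_shift.
have derivative w : exists w', V w -> V w' /\ forall t, cderiv w t (w' t).
  case: (pselect (V w)) => [/derivable [_ [w' w'P]]|nVw]; first by exists w'.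
  by exists w => /nVw.
have [D DV] := choice derivative.
pose W k := iter k D g.
have VW k : V (W k) by elim: k => //= k /DV [].
have [s Vs] := V_finite.
have [n /in_span_iota [c Wn]] := sequence_dependent (fun k => Vs _ (VW k)).
pose a k := if k == n then 1 else - c k.
apply: (exp_poly1_linear_ode (n := n) (a := a) (W := W)) => [|k t|t].
- by rewrite /a eqxx.
- by have [_] := DV _ (VW k); apply.
rewrite big_ord_recr Wn /a eqxx Cmul1z /= -big_split big1 // => k _ /=.
by rewrite (ltn_eqF (ltn_ord k)); ring.
Qed.

End FiniteRankTranslates1.

(** * Points of R^d, convergence and continuity *)

Definition vzero {d} : Pt d := fun=> 0.

Declare Scope pt_scope.
Delimit Scope pt_scope with V.
Bind Scope pt_scope with Pt.
Arguments vnorm {d} x%_V.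
Notation "0" := vzero : pt_scope.
Notation "x + y" := (vadd x y) : pt_scope.
Notation "a *: x" := (vscal a x) (at level 40) : pt_scope.
Notation "- x" := (vscal (-1) x) : pt_scope.
Notation "x - y" := (vadd x (vscal (-1) y)) : pt_scope.

Ltac pt_ring := apply: funext => ?; rewrite /vadd /vscal /vzero; ring.

Lemma vaddA d : associative (@vadd d). Proof. by move=> *; pt_ring. Qed.
Lemma vaddC d : commutative (@vadd d). Proof. by move=> *; pt_ring. Qed.
Lemma vaddx0 d : right_id (@vzero d) (@vadd d). Proof. by move=> *; pt_ring. Qed.
Lemma vadd0x d : left_id (@vzero d) (@vadd d). Proof. by move=> *; pt_ring. Qed.

Section RealSums.
Variables (I : Type) (r : seq I).
Implicit Types F G : I -> R.

Lemma Rsum_le F G : (forall i, F i <= G i) ->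
  \big[Rplus/0]_(i <- r) F i <= \big[Rplus/0]_(i <- r) G i.
Proof. by move=> FG; elim/big_ind2: _ => [|? ? ? ? ? ?|i _]; [lra | lra | exact: FG]. Qed.

Lemma Rsum_ge0 (P : pred I) F : (forall i, 0 <= F i) -> 0 <= \big[Rplus/0]_(i <- r | P i) F i.
Proof. by move=> F0; elim/big_ind: _ => [|? ? ? ?|i _]; [lra | lra | exact: F0]. Qed.

Lemma Rsum_const a : \big[Rplus/0]_(i <- r) a = INR (size r) * a.
Proof.
elim: r => [|i s IH]; first by rewrite big_nil /=; lra.
by rewrite big_cons IH -[size (i :: s)]/(size s).+1 S_INR; lra.
Qed.

End RealSums.

Lemma vnorm_ge0 d (x : Pt d) : 0 <= vnorm x. Proof. exact: sqrt_pos. Qed.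

Lemma Rabs_coord_le_vnorm d (x : Pt d) i : Rabs (x i) <= vnorm x.
Proof.
rewrite /vnorm -sqrt_Rsqr_abs; apply: sqrt_le_1_alt; rewrite (bigD1 i) //.
set rest := (X in _ <= _ + X); have : 0 <= rest by apply: Rsum_ge0 => j; exact: pow2_ge_0.
by rewrite /Rsqr /=; lra.
Qed.

Lemma vnorm_le_sum d (x : Pt d) : vnorm x <= \big[Rplus/0]_(i < d) Rabs (x i).
Proof.
have sums (r : seq 'I_d) : 0 <= \big[Rplus/0]_(i <- r) Rabs (x i) /\
    \big[Rplus/0]_(i <- r) x i ^ 2 <= (\big[Rplus/0]_(i <- r) Rabs (x i)) ^ 2.
  elim: r => [|i r [IH0 IH]]; first by rewrite !big_nil; lra.
  by rewrite !big_cons -(pow2_abs (x i)); have := Rabs_pos (x i); split; [lra | nra].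
have [sum_ge0 sum_sqr] := sums (index_enum 'I_d).
by rewrite /vnorm -[X in _ <= X]sqrt_pow2 //; exact: sqrt_le_1_alt.
Qed.

Lemma vnorm_le d (x : Pt d) M : (forall i, Rabs (x i) <= M) -> vnorm x <= INR d * M.
Proof.
move=> xM; apply: Rle_trans (vnorm_le_sum x) _.
apply: Rle_trans (Rsum_le _ xM) _.
by rewrite -big_enum Rsum_const size_enum_ord; lra.
Qed.

Lemma Rabs_scal_unit_vec_le d (i j : 'I_d) s : Rabs (s * unit_vec i j) <= Rabs s.
Proof.
by rewrite Rabs_mult /unit_vec; case: (_ == _); rewrite ?Rabs_R1 ?Rabs_R0; have := Rabs_pos s; lra.
Qed.

Lemma invS_gt0 n : 0 < / INR n.+1.
Proof. by apply/Rinv_0_lt_compat/lt_0_INR; lia. Qed.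

Lemma invS_le1 n : / INR n.+1 <= 1.
Proof.
rewrite -[X in _ <= X]Rinv_1; apply: Rinv_le_contravar; first lra.
by rewrite S_INR; have := pos_INR n; lra.
Qed.

Lemma invS_small eps : 0 < eps -> exists N, forall n, (N <= n)%N -> / INR n.+1 < eps.
Proof.
move=> eps0; have [N [N_eps N0]] := archimed_cor1 eps eps0.
exists N => n /leP Nn; apply: Rle_lt_trans N_eps.
by apply: Rinv_le_contravar; [exact: lt_0_INR | apply: le_INR; lia].
Qed.

Lemma Un_cvP u l : Un_cv u l <->
  forall eps, 0 < eps -> exists N, forall n, (N <= n)%N -> Rabs (u n - l) < eps.
Proof.
by split=> ul eps /ul [N uN]; exists N => n; [move/leP/uN | move/leP; exact: uN].
Qed.

Lemma Un_cv_invS u l : (forall n, Rabs (u n - l) <= / INR n.+1) -> Un_cv u l.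
Proof.
move=> ul; apply/Un_cvP => eps /invS_small [N invN]; exists N => n /invN.
exact: Rle_lt_trans.
Qed.

Lemma Un_cv_subseq u l (s : nat -> nat) :
  (forall n, (n <= s n)%N) -> Un_cv u l -> Un_cv (fun n => u (s n)) l.
Proof.
move=> sn /Un_cvP ul; apply/Un_cvP => eps /ul [N uN]; exists N => n Nn.
exact/uN/(leq_trans Nn).
Qed.

Lemma Un_cv_const a : Un_cv (fun=> a) a.
Proof. by move=> eps eps0; exists 0%N => n _; rewrite Rdist_eq. Qed.

Lemma CvP u l : Cv u l <->
  forall eps, 0 < eps -> exists N, forall n, (N <= n)%N -> Cnorm (u n - l) < eps.
Proof.
split=> [[/Un_cvP u1 /Un_cvP u2] eps eps0|ul].
  have [N1 uN1] := u1 (eps / 2) ltac:(lra); have [N2 uN2] := u2 (eps / 2) ltac:(lra).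
  exists (maxn N1 N2) => n; rewrite geq_max => /andP [/uN1 h1 /uN2 h2].
  by apply: Rle_lt_trans (Cnorm_le_sum _) _; move: h1 h2; rewrite /= /Rminus; lra.
split; apply/Un_cvP => eps /ul [N uN]; exists N => n /uN; apply: Rle_lt_trans.
  exact: (Rabs_fst_le (u n - l)%C).
exact: (Rabs_snd_le (u n - l)%C).
Qed.

Lemma Cv_ext u v l : Cv u l -> u =1 v -> Cv v l.
Proof. by move=> ul /funext <-. Qed.

Lemma Cv_unique u l l' : Cv u l -> Cv u l' -> l = l'.
Proof.
case: l l' => [a b] [a' b'] [/= ua ub] [/= ua' ub'].
by rewrite (UL_sequence _ _ _ ua ua') (UL_sequence _ _ _ ub ub').
Qed.

Lemma Cv_const z : Cv (fun=> z) z.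
Proof. by split; exact: Un_cv_const. Qed.

Lemma CvD u v a b : Cv u a -> Cv v b -> Cv (fun n => u n + v n)%C (a + b).
Proof. by move=> [? ?] [? ?]; split; apply: CV_plus. Qed.

Lemma CvB u v a b : Cv u a -> Cv v b -> Cv (fun n => u n - v n)%C (a - b).
Proof. by move=> [? ?] [? ?]; split; apply: CV_minus. Qed.

Lemma CvM u v a b : Cv u a -> Cv v b -> Cv (fun n => u n * v n)%C (a * b).
Proof.
by move=> [? ?] [? ?]; split; [apply: CV_minus | apply: CV_plus]; apply: CV_mult.
Qed.

Lemma Cv_sum (I : Type) (r : seq I) (F : I -> nat -> Cplx) (L : I -> Cplx) :
  (forall i, Cv (F i) (L i)) -> Cv (fun n => \sum_(i <- r) F i n)%C (\sum_(i <- r) L i).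
Proof.
move=> FL; elim: r => [|i r IH].
  by rewrite big_nil; apply: Cv_ext (Cv_const 0) _ => n; rewrite big_nil.
rewrite big_cons; apply: Cv_ext (CvD (FL i) IH) _ => n.
by rewrite big_cons.
Qed.

Lemma Cv_RtoC u a : Un_cv u a -> Cv (fun n => (u n)%:C) a%:C.
Proof. by move=> ua; split=> //; exact: Un_cv_const. Qed.

Lemma Cv_eventually u v l N : (forall n, (N <= n)%N -> u n = v n) -> Cv u l -> Cv v l.
Proof.
move=> uv /CvP ul; apply/CvP => eps /ul [N' uN']; exists (maxn N N') => n.
by rewrite geq_max => /andP [/uv <- /uN'].
Qed.

Lemma Cv_subseq u l (s : nat -> nat) :
  (forall n, (n <= s n)%N) -> Cv u l -> Cv (fun n => u (s n)) l.
Proof.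
move=> sn [u1 u2]; split.
  exact: (Un_cv_subseq (u := fun n => fst (u n))).
exact: (Un_cv_subseq (u := fun n => snd (u n))).
Qed.

Lemma Cnorm_lim_le u l z B : Cv u l -> (forall n, Cnorm (u n - z) <= B) -> Cnorm (l - z) <= B.
Proof.
move=> /CvP ul uB; apply: Rnot_lt_le => lB.
have [N uN] := ul (Cnorm (l - z) - B) ltac:(lra).
have := uN N (leqnn N); have := uB N; have := Cnorm_sub_triangle l (u N) z.
by rewrite (Cnorm_subC l (u N)); lra.
Qed.

Lemma Cauchy_Cv (u : nat -> Cplx) :
  (forall eps, 0 < eps -> exists N, forall n m, (N <= n)%N -> (N <= m)%N ->
    Cnorm (u n - u m) < eps) ->
  exists l, Cv u l.
Proof.
move=> cauchy.
have complete (pr : Cplx -> R) : (forall n m, Rabs (pr (u n) - pr (u m)) <= Cnorm (u n - u m)) ->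
    {l | Un_cv (fun n => pr (u n)) l}.
  move=> pr_le; apply: R_complete => eps /cauchy [N uN]; exists N => n m /leP Nn /leP Nm.
  exact: Rle_lt_trans (pr_le n m) (uN n m Nn Nm).
have [a ua] := complete fst (fun n m => Rabs_fst_le (u n - u m)%C).
have [b ub] := complete snd (fun n m => Rabs_snd_le (u n - u m)%C).
by exists (a, b).
Qed.

Section Continuity.
Variable d : nat.
Implicit Types (f g : Fn d) (x y : Pt d) (u : nat -> Pt d).

Definition within (del : R) x y := forall i, Rabs (x i - y i) <= del.

Definition pt_cv u x := forall i, Un_cv (fun n => u n i) (x i).

Lemma pt_cvP u x : pt_cv u x <->
  forall eps, 0 < eps -> exists N, forall n, (N <= n)%N -> within eps (u n) x.
Proof.
split=> [ux eps eps0|ux i]; last first.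
  apply/Un_cvP => eps eps0; have [N uN] := ux (eps / 2) ltac:(lra).
  by exists N => n /uN /(_ i); lra.
have /choice [N uN] i := (proj1 (Un_cvP _ _) (ux i)) eps eps0.
exists (\max_i N i)%N => n maxN i; apply/Rlt_le/uN.
exact: leq_trans (leq_bigmax i) maxN.
Qed.

Lemma Ccont_withinP f : Ccont f <-> forall x eps, 0 < eps ->
  exists del, 0 < del /\ forall y, within del y x -> Cnorm (f y - f x) < eps.
Proof.
have subE x y i : (y - x)%V i = y i - x i by rewrite /vadd /vscal; ring.
split=> cf x eps /(cf x) [del [del0 fdel]].
  have d0 : 0 < INR d + 1 by have := pos_INR d; lra.
  exists (del / (INR d + 1)); split; first exact: Rdiv_lt_0_compat.
  move=> y yx; apply: fdel; apply: (Rle_lt_trans _ (INR d * (del / (INR d + 1)))).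
    by apply: vnorm_le => i; rewrite subE.
  have -> : INR d * (del / (INR d + 1)) = del - del / (INR d + 1) by field; lra.
  by have := Rdiv_lt_0_compat _ _ del0 d0; lra.
exists del; split=> // y yx; apply: fdel => i; apply: Rle_trans (Rlt_le _ _ yx).
by rewrite -subE; exact: Rabs_coord_le_vnorm.
Qed.

Lemma Ccont_seqP f : Ccont f <-> forall u x, pt_cv u x -> Cv (fun n => f (u n)) (f x).
Proof.
split=> [/Ccont_withinP cf u x /pt_cvP ux|cf].
  by apply/CvP => eps /(cf x) [del [/ux [N uN] fdel]]; exists N => n /uN; exact: fdel.
apply/Ccont_withinP => x eps eps0; apply: contrapT => ncf.
have /choice [u uP] (n : nat) : exists y, within (/ INR n.+1) y x /\ ~ Cnorm (f y - f x) < eps.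
  apply: contrapT => ny; apply: ncf; exists (/ INR n.+1); split=> [|y yx]; first exact: invS_gt0.
  by apply: contrapT => nf; apply: ny; exists y.
have /cf /CvP /(_ eps eps0) [N fN] : pt_cv u x by move=> i; apply: Un_cv_invS => n; case: (uP n).
by case: (uP N) => _; apply; exact: fN.
Qed.

Lemma Ccont_const z : Ccont (fun _ : Pt d => z).
Proof. by apply/Ccont_seqP => u x _; exact: Cv_const. Qed.

Lemma Ccont_lin f g z : Ccont f -> Ccont g -> Ccont (fun x => f x + z * g x)%C.
Proof.
move=> /Ccont_seqP cf /Ccont_seqP cg; apply/Ccont_seqP => u x ux.
by apply: CvD; [exact: cf | apply: CvM; [exact: Cv_const | exact: cg]].
Qed.

Lemma Ccont_subspace : subspace (@Ccont d).
Proof. by split=> [|c f g]; [exact: Ccont_const | exact: Ccont_lin]. Qed.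

Lemma CcontM f g : Ccont f -> Ccont g -> Ccont (fun x => f x * g x)%C.
Proof.
move=> /Ccont_seqP cf /Ccont_seqP cg; apply/Ccont_seqP => u x ux.
by apply: CvM; [exact: cf | exact: cg].
Qed.

Lemma Ccont_affine f a y : Ccont f -> Ccont (fun x => f (a *: x + y)%V).
Proof.
move=> /Ccont_seqP cf; apply/Ccont_seqP => u x ux; apply: cf => i.
by apply: CV_plus (Un_cv_const _); apply: CV_mult => //; exact: Un_cv_const.
Qed.

Lemma Ccont_shift f y : Ccont f -> Ccont (fun x => f (x + y)%V).
Proof.
move=> /(Ccont_affine 1 y) cf; apply: subst_eqfun cf _ => x.
by congr f; pt_ring.
Qed.

Lemma Ccont_coord_slice f i : Ccont f -> ccont1 (fun t => f (t *: unit_vec i)%V).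
Proof.
move=> /Ccont_withinP cf t.
have slice (pr : Cplx -> R) : (forall z w, pr (z - w)%C = pr z - pr w) ->
    (forall z, Rabs (pr z) <= Cnorm z) -> continuity_pt (fun s => pr (f (s *: unit_vec i)%V)) t.
  move=> prB pr_le; apply/continuity_pt_locally => eps.
  have [del [del0 fdel]] := cf (t *: unit_vec i)%V eps (cond_pos eps).
  exists (mkposreal del del0) => s st; rewrite -prB; apply: Rle_lt_trans (pr_le _) _.
  apply: fdel => j; rewrite /vscal -Rmult_minus_distr_r.
  exact: Rle_trans (Rabs_scal_unit_vec_le _ _ _) (Rlt_le _ _ st).
by split; apply: slice => // z; [exact: Rabs_fst_le | exact: Rabs_snd_le].
Qed.

End Continuity.

(** * Exponential polynomials *)

Section ExpPoly.
Variable d : nat.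
Local Open Scope cplx_scope.
Implicit Types f g : Fn d.

Inductive exp_poly : Fn d -> Prop :=
| exp_poly_const z : exp_poly (fun=> z)
| exp_poly_coord i : exp_poly (fun x => (x i)%:C)
| exp_poly_expc mu i : exp_poly (fun x => expc mu (x i))
| exp_polyD f g : exp_poly f -> exp_poly g -> exp_poly (fun x => f x + g x)
| exp_polyM f g : exp_poly f -> exp_poly g -> exp_poly (fun x => f x * g x).

Lemma exp_poly_subspace : subspace exp_poly.
Proof.
split=> [|c f g Ef Eg]; first exact: exp_poly_const.
by apply: exp_polyD => //; apply: exp_polyM => //; exact: exp_poly_const.
Qed.

Lemma exp_poly_prod (I : Type) (r : seq I) (F : I -> Fn d) : (forall i, exp_poly (F i)) ->
  exp_poly (fun x => \prod_(i <- r) F i x).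
Proof.
move=> EF; elim: r => [|i r IH].
  by apply: subst_eqfun (exp_poly_const 1) _ => x; rewrite big_nil.
by apply: subst_eqfun (exp_polyM (EF i) IH) _ => x; rewrite big_cons.
Qed.

Lemma exp_poly_pow i k : exp_poly (fun x => (x i ^ k)%:C).
Proof.
elim: k => [|k IH]; first exact: (exp_poly_const 1).
by apply: subst_eqfun (exp_polyM (exp_poly_coord i) IH) _ => x; rewrite -RtoCM.
Qed.

Lemma exp_poly_of_exp_poly1 (g : R -> Cplx) i : exp_poly1 g -> exp_poly (fun x => g (x i)).
Proof.
elim=> [k mu|c f h _ Ef _ Eh]; last exact: (proj2 exp_poly_subspace).
by apply: exp_polyM; [exact: exp_poly_pow | exact: exp_poly_expc].
Qed.

Lemma Cexp_cdot (lam : 'I_d -> Cplx) (x : Pt d) :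
  Cexp (cdot lam x) = \prod_(i < d) expc (lam i) (x i).
Proof.
rewrite -(big_morph Cexp CexpD Cexp0); congr Cexp.
rewrite /cdot; elim: (index_enum _) => [|i r IH]; first by rewrite !big_nil.
by rewrite !big_cons -IH /Cadd /Cmul /RtoC /=; congr pair; ring.
Qed.

Lemma is_exp_poly_exp_poly f : is_exp_poly f -> exp_poly f.
Proof.
move=> [terms /fsym fE]; apply: subst_eqfun fE.
have exp_monomial (a : 'I_d -> nat) : exp_poly (fun x => (monom a x)%:C).
  apply: subst_eqfun (exp_poly_prod (index_enum 'I_d) (fun i => exp_poly_pow i (a i))) _ => x.
  by rewrite RtoC_prod.
have exp_poly_eval (p : seq (Cplx * ('I_d -> nat))) : exp_poly (poly_eval p).
  elim: p => [|ca p IH]; first exact: exp_poly_const.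
  by apply: exp_polyD IH; apply: exp_polyM; [exact: exp_poly_const | exact: exp_monomial].
have exp_cdot (lam : 'I_d -> Cplx) : exp_poly (fun x => Cexp (cdot lam x)).
  apply: subst_eqfun (fun x => esym (Cexp_cdot lam x)).
  by apply: exp_poly_prod => i; exact: exp_poly_expc.
elim: terms => [|pl terms IH]; first exact: exp_poly_const.
by apply: exp_polyD IH; exact: exp_polyM.
Qed.

Record term := Term { coefficient : Cplx; degrees : 'I_d -> nat; frequency : 'I_d -> Cplx }.

Definition term_eval (t : term) (x : Pt d) : Cplx :=
  coefficient t * (monom (degrees t) x)%:C * Cexp (cdot (frequency t) x).

Definition term_mul (t u : term) : term :=
  Term (coefficient t * coefficient u) (fun i => degrees t i + degrees u i)%N
       (fun i => frequency t i + frequency u i).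

Lemma term_evalM t u x : term_eval (term_mul t u) x = term_eval t x * term_eval u x.
Proof.
have -> : term_eval (term_mul t u) x = coefficient t * coefficient u *
    (monom (degrees t) x * monom (degrees u) x)%R%:C *
    Cexp (cdot (frequency t) x + cdot (frequency u) x).
  rewrite /term_eval; congr (_ * RtoC _ * Cexp _).
    by rewrite /monom -big_split; apply: eq_bigr => i _; rewrite pow_add.
  by rewrite /cdot /Cadd /= -!big_split; congr pair; apply: eq_bigr => i _ /=; ring.
by rewrite CexpD RtoCM /term_eval; ring.
Qed.

Lemma exp_poly_sum_terms f : exp_poly f ->
  exists r : seq term, forall x, f x = \sum_(t <- r) term_eval t x.
Proof.
have monom0 (x : Pt d) : monom (fun=> 0%N) x = 1%R by rewrite /monom big1.
have Cexp_cdot0 (x : Pt d) : Cexp (cdot (fun=> 0) x) = 1.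
  by rewrite Cexp_cdot big1 // => i _; rewrite expc0.
elim=> [z|i|mu i|g h _ [r gE] _ [r' hE]|g h _ [r gE] _ [r' hE]].
- exists [:: Term z (fun=> 0%N) (fun=> 0)] => x.
  by rewrite big_seq1 /term_eval /= monom0 Cexp_cdot0; ring.
- exists [:: Term 1 (fun j => nat_of_bool (j == i)) (fun=> 0)] => x.
  rewrite big_seq1 /term_eval /= Cexp_cdot0 /monom (bigD1 i) //= eqxx big1 => [|j /negbTE -> //].
  by rewrite /= !Rmult_1_r; ring.
- exists [:: Term 1 (fun=> 0%N) (fun j => if j == i then mu else 0)] => x.
  rewrite big_seq1 /term_eval /= monom0 Cexp_cdot (bigD1 i) //= eqxx big1 => [|j /negbTE ->].
    by ring.
  exact: expc0.
- by exists (r ++ r') => x; rewrite big_cat gE hE.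
exists [seq term_mul t u | t <- r, u <- r'] => x.
rewrite big_allpairs_dep gE hE (big_distrlr Cadd) /=.
by do 2![apply: eq_bigr => ? _]; rewrite term_evalM.
Qed.

Lemma is_exp_polyP f : is_exp_poly f <-> exp_poly f.
Proof.
split=> [|/exp_poly_sum_terms [r fE]]; first exact: is_exp_poly_exp_poly.
exists [seq ([:: (coefficient t, degrees t)], frequency t) | t <- r] => x; rewrite fE.
elim: r {fE} => [|t r IH] /=; first by rewrite big_nil.
by rewrite big_cons IH /term_eval; congr (_ * _ + _); ring.
Qed.

Lemma exp_poly_Ccont f : exp_poly f -> Ccont f.
Proof.
elim=> [z|i|mu i|g h _ cg _ ch|g h _ cg _ ch]; first exact: Ccont_const.
- by apply/Ccont_seqP => u x ux; exact/Cv_RtoC/ux.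
- apply/Ccont_seqP => u x ux; have [mu1 mu2] := CvM (Cv_const mu) (Cv_RtoC (ux i)).
  have seq_cont (k : R -> R) v a : continuity k -> Un_cv v a -> Un_cv (fun n => k (v n)) (k a).
    by move=> ck; apply: continuity_seq; exact: ck.
  have cexp := derivable_continuous _ derivable_exp.
  by split; apply: CV_mult; apply: seq_cont => //; [exact: continuity_cos | exact: continuity_sin].
- exact: (subspaceD (@Ccont_subspace d)).
- exact: CcontM.
Qed.

Lemma exp_poly_finite_rank f : exp_poly f -> exists s, (forall u, u \in s -> exp_poly u) /\
  forall y, in_span s (fun x => f (x + y)%V).
Proof.
elim=> [z|i|mu i|g h _ [s [Es sg]] _ [s' [Es' s'h]]|g h _ [s [Es sg]] _ [s' [Es' s'h]]].
- exists [:: fun=> 1]; split=> [u|y]; first by rewrite inE => /eqP ->; exact: exp_poly_const.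
  by exists z => x; ring.
- exists [:: fun x => (x i)%:C; fun=> 1]; split=> [u|y].
    by rewrite !inE => /orP [] /eqP ->; [exact: exp_poly_coord | exact: exp_poly_const].
  by exists 1, (y i)%:C => x; rewrite /vadd RtoCD; ring.
- exists [:: fun x => expc mu (x i)]; split=> [u|y].
    by rewrite inE => /eqP ->; exact: exp_poly_expc.
  by exists (expc mu (y i)) => x; rewrite /vadd /expc RtoCD CmulDr CexpD; ring.
- exists (s ++ s'); split=> [u|y]; first by rewrite mem_cat => /orP [/Es|/Es'].
  apply: (subspaceD (in_span_subspace _)); first exact: in_span_catl.
  exact: in_span_catr.
exists [seq (fun x => p x * q x) | p <- s, q <- s']; split=> [u|y]; last exact: in_span_mul.
by move=> /allpairsP [[p q] /= [/Es Ep /Es' Eq ->]]; exact: exp_polyM.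
Qed.

End ExpPoly.

(** * Functions with finite-dimensional spaces of translates *)

Section FiniteRankTranslates.
Variables (d : nat) (f : Fn d).
Hypotheses (cont_f : Ccont f) (rank_f : finite_rank (fun y x => f (x + y)%V)).

Let V := translates_span (@vadd d) f.

Let V_Ccont w : V w -> Ccont w.
Proof. by apply: translates_span_min => [|y]; [exact: Ccont_subspace | exact: Ccont_shift]. Qed.

Let exp_poly1_slice w i : V w -> exp_poly1 (fun t => w (t *: unit_vec i)%V).
Proof.
move=> Vw; apply: finite_rank_exp_poly1; first exact/Ccont_coord_slice/V_Ccont.
have [s sf] := rank_f; exists [seq (fun t => u (t *: unit_vec i)%V) | u <- s] => a.
have sw : in_span s (fun x => w (x + a *: unit_vec i)%V).
  apply: translates_span_min (translates_span_stable (@vaddA d) (a *: unit_vec i)%V Vw) => //.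
  exact: in_span_subspace.
apply: subst_eqfun (in_span_comp (fun t => (t *: unit_vec i)%V) sw) _ => t.
by congr w; pt_ring.
Qed.

Let exp_poly_add_coord i (P : Pt d -> Pt d) : (forall y, exp_poly (fun x => f (y + P x)%V)) ->
  exp_poly (fun x => f (x i *: unit_vec i + P x)%V).
Proof.
move=> EP; have [s sf] := rank_f.
have Vs w : V w -> in_span s w by apply: translates_span_min => //; exact: in_span_subspace.
have [l [Vl repr]] := reproducing_points (translates_span_subspace _ f) Vs.
have Esum : exp_poly (fun x => \sum_(p <- l | p \in l)
    (f (p.1 + P x)%V * p.2 (x i *: unit_vec i)%V))%C.
  apply: subspace_sum => [|p lp]; first exact: exp_poly_subspace.
  apply: exp_polyM (EP p.1) _.
  apply: (exp_poly_of_exp_poly1 (g := fun t => p.2 (t *: unit_vec i)%V)).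
  by apply/exp_poly1_slice/Vl; exact: map_f.
apply: subst_eqfun Esum _ => x; rewrite -big_seq.
exact/esym/(repr _ (translates_span_gen _ f (P x))).
Qed.

Theorem finite_rank_exp_poly : exp_poly f.
Proof.
pose trunc n (x : Pt d) : Pt d := fun i => if (i < n)%N then x i else 0.
suff exp_trunc n : (n <= d)%N -> forall y, exp_poly (fun x => f (y + trunc n x)%V).
  apply: subst_eqfun (exp_trunc d (leqnn d) 0%V) _ => x; congr f.
  by rewrite vadd0x; apply: funext => i; rewrite /trunc ltn_ord.
elim: n => [|n IH] nd y.
  apply: subst_eqfun (exp_poly_const d (f y)) _ => x; congr f.
  by apply: funext => i; rewrite /vadd /trunc ltn0; ring.
pose i := Ordinal nd.
have exp_add y' : exp_poly (fun x => f (y' + (y + trunc n x))%V).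
  by apply: subst_eqfun (IH (ltnW nd) (y' + y)%V) _ => x; rewrite vaddA.
apply: subst_eqfun (exp_poly_add_coord i exp_add) _ => x; congr f; apply: funext => j.
rewrite /vadd /vscal /unit_vec /trunc ltnS [(j <= n)%N]leq_eqVlt.
have [->|ji] := eqVneq j i; first by rewrite eqxx ltnn /=; ring.
by rewrite (negbTE (_ : nat_of_ord j != n)) //=; ring.
Qed.

End FiniteRankTranslates.

Definition diff_coef (m k : nat) : Cplx := RtoC (Binomial.C m k * (-1) ^ (m - k)%nat).

Lemma diff_coef_neq0 m k : diff_coef m k <> C0.
Proof.
have fact0 := INR_fact_neq_0.
move=> /RtoC_inj; apply: Rmult_integral_contrapositive_currified; last by apply: pow_nonzero; lra.
apply: Rmult_integral_contrapositive_currified => //.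
by apply/Rinv_neq_0_compat/Rmult_integral_contrapositive_currified.
Qed.

Section DenseGroup.
Variables (X : Type) (d t : nat) (h : 'I_t -> Pt d) (m : 'I_t -> nat).
Variable A : Pt d -> X -> Cplx.
Hypothesis rank_diff : forall k, finite_rank (fun y x =>
  \sum_(j < (m k).+1) (diff_coef (m k) j * A (y + INR j *: h k)%V x))%C.

Let group_pt n (z : 'I_t -> Z) : Pt d :=
  fun i => \big[Rplus/0]_(k < t | (k < n)%N) (IZR (z k) * h k i).

Let group_ptS n (nt : (n < t)%N) z :
  group_pt n.+1 z = (IZR (z (Ordinal nt)) *: h (Ordinal nt) + group_pt n z)%V.
Proof.
apply: funext => i; rewrite /vadd /vscal /group_pt (bigD1 (Ordinal nt)) //=; congr Rplus.
by apply: eq_bigl => k; rewrite ltnS -val_eqE /= [in RHS]ltn_neqAle andbC.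
Qed.

Let finite_rank_on_group n : (n <= t)%N -> forall y, finite_rank (fun z => A (y + group_pt n z)%V).
Proof.
elim: n => [|n IH] nt y.
  exists [:: A y] => z; suff -> : group_pt 0 z = 0%V by rewrite vaddx0; exact: in_span_head.
  by apply: funext => i; rewrite /group_pt big_pred0_eq.
pose k := Ordinal nt.
have [w wdiff] := rank_diff k.
have [s sA] := finite_rank_family (fun j : 'I_(m k) => IH (ltnW nt) (y + INR j *: h k)%V).
exists (w ++ s) => z; pose b q := A (y + IZR q *: h k + group_pt n z)%V.
have -> : A (y + group_pt n.+1 z)%V = b (z k) by rewrite group_ptS vaddA.
apply: (two_sided_recurrence (in_span_subspace _) (m := m k) (c := diff_coef (m k))).
- exact: diff_coef_neq0.
- exact: diff_coef_neq0.
- move=> q; apply: in_span_catl.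
  apply: subst_eqfun (wdiff (y + IZR q *: h k + group_pt n z)%V) _ => x.
  apply: eq_bigr => j _; congr (_ * A _ x)%C; apply: funext => i.
  by rewrite /vadd /vscal plus_IZR -INR_IZR_INZ; ring.
- by move=> j jm; apply: in_span_catr; have := sA (Ordinal jm) z; rewrite /b -INR_IZR_INZ.
Qed.

Let dense_approximation :
  dense_subgroup h -> forall y, exists z, pt_cv (fun n => group_pt t (z n)) y.
Proof.
move=> dense y.
have /choice [z zy] (n : nat) : exists z, forall i, Rabs (group_pt t z i - y i) <= / INR n.+1.
  have [z zy] := dense y _ (invS_gt0 n); exists z => i; apply: Rle_trans (Rlt_le _ _ zy).
  apply: Rle_trans (Rabs_coord_le_vnorm _ i); apply: Req_le; congr Rabs.
  rewrite /vadd /vscal /group_pt /Rminus; congr Rplus; last by ring.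
  by apply: eq_bigl => k; rewrite ltn_ord.
by exists z => i; apply: Un_cv_invS => n; exact: zy.
Qed.

Lemma finite_rank_of_differences :
  dense_subgroup h -> (forall x, Ccont (A^~ x)) -> finite_rank A.
Proof.
move=> /dense_approximation dense cA.
have [l repr] := finite_rank_interpolate (finite_rank_on_group (leqnn t) 0%V).
apply: (interpolate_finite_rank (l := l)) => y x; have [z zy] := dense y.
have limA x' : Cv (fun n => A (group_pt t (z n)) x') (A y x').
  exact: (proj1 (Ccont_seqP _) (cA x')).
apply: Cv_unique (limA x) _.
have := Cv_sum l (fun p => CvM (limA p.1) (Cv_const (p.2 x))).
move/Cv_ext; apply=> n.
by have := repr (z n) x; rewrite vadd0x => ->.
Qed.

End DenseGroup.

Theorem is_exp_poly_of_differences (d t : nat) (h : 'I_t -> Pt d) (m : 'I_t -> nat) (f : Fn d) :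
  dense_subgroup h -> Ccont f ->
  (forall k : 'I_t, is_exp_poly (FDelta (h k) (m k) f)) -> is_exp_poly f.
Proof.
move=> dense cf exp_diff; apply/is_exp_polyP/finite_rank_exp_poly => //.
apply: (finite_rank_of_differences (m := m)) dense _ => [k|x].
  have [s [_ sdiff]] := exp_poly_finite_rank (proj1 (is_exp_polyP _) (exp_diff k)).
  exists s => y; apply: subst_eqfun (sdiff y) _ => x.
  by apply: eq_bigr => j _; congr Cmul; congr f; rewrite vaddA.
by apply: subst_eqfun (Ccont_shift x cf) _ => y; rewrite vaddC.
Qed.

(** * Continuous functions of compact support *)

Section CompactSupport.
Variable d : nat.
Implicit Types (f g : Fn d) (u : nat -> Pt d).

Definition box_supp (M : R) f := forall x i, M < Rabs (x i) -> f x = C0.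

Definition Cc f := Ccont f /\ exists M, box_supp M f.

Lemma box_supp_neq0 M f x : box_supp M f -> f x <> C0 -> forall i, Rabs (x i) <= M.
Proof. by move=> supp fx i; apply: Rnot_lt_le => /supp. Qed.

Lemma box_supp_le M M' f : M <= M' -> box_supp M f -> box_supp M' f.
Proof. by move=> MM' supp x i xi; apply: (supp x i); lra. Qed.

Lemma supp_in_box f r : supp_in f r -> box_supp r f.
Proof.
by move=> supp x i xi; apply: supp; apply: Rlt_le_trans xi _; exact: Rabs_coord_le_vnorm.
Qed.

Lemma box_supp_in f M : box_supp M f -> supp_in f (INR d * M).
Proof.
move=> supp x xM; apply: contrapT => fx.
by have := vnorm_le (box_supp_neq0 supp fx); lra.
Qed.

Lemma Cc_supp f : Cc f -> exists M, 0 <= M /\ box_supp M f.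
Proof.
move=> [_ [M supp]]; exists (Rmax M 0); split; first exact: Rmax_r.
exact: box_supp_le (Rmax_l _ _) supp.
Qed.

Lemma common_box_supp f g : Cc f -> Cc g -> exists M, 0 <= M /\ box_supp M f /\ box_supp M g.
Proof.
move=> /Cc_supp [M1 [M1_ge0 supp1]] /Cc_supp [M2 [_ supp2]].
have [max1 max2] := (Rmax_l M1 M2, Rmax_r M1 M2).
exists (Rmax M1 M2); split; first lra.
by split; [exact: box_supp_le supp1 | exact: box_supp_le supp2].
Qed.

Lemma box_supp_lin M f g z :
  box_supp M f -> box_supp M g -> box_supp M (fun x => f x + z * g x)%C.
Proof. by move=> sf sg x i xi; rewrite (sf x i) // (sg x i) //; ring. Qed.

Lemma box_suppMr M f g : box_supp M g -> box_supp M (fun x => f x * g x)%C.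
Proof. by move=> sg x i xi; rewrite (sg x i) //; ring. Qed.

Lemma box_supp_shift M M' f y : (forall i, Rabs (y i) <= M') ->
  box_supp M f -> box_supp (M + M') (fun x => f (x + y)%V).
Proof.
move=> yM supp x i xi; apply: (supp _ i); have := Rabs_triang (x i + y i) (- y i).
rewrite Rabs_Ropp (_ : x i + y i + - y i = x i); last by ring.
by have := yM i; rewrite /vadd; lra.
Qed.

Lemma Cc_lin f g z : Cc f -> Cc g -> Cc (fun x => f x + z * g x)%C.
Proof.
move=> ccf ccg; have [M [_ [sf sg]]] := common_box_supp ccf ccg.
by split; [apply: Ccont_lin; [case: ccf | case: ccg] | exists M; exact: box_supp_lin].
Qed.

Lemma Cc_subspace : subspace Cc.
Proof. by split=> [|c f g]; [split; [exact: Ccont_const | exists 0] | exact: Cc_lin]. Qed.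

Lemma CcM f g : Ccont f -> Cc g -> Cc (fun x => f x * g x)%C.
Proof. by move=> cf [cg [M sg]]; split; [exact: CcontM | exists M; exact: box_suppMr]. Qed.

Lemma Cc_shift f y : Cc f -> Cc (fun x => f (x + y)%V).
Proof.
move=> [cf [M sf]]; split; first exact: Ccont_shift.
by exists (M + vnorm y); apply: box_supp_shift sf => i; exact: Rabs_coord_le_vnorm.
Qed.

Lemma bounded_subsequence (u : nat -> R) M : (forall n, Rabs (u n) <= M) ->
  exists s l, (forall n, (n <= s n)%N) /\ Un_cv (fun n => u (s n)) l.
Proof.
move=> uM; have [l adh_l] := Bolzano_Weierstrass u (fun x => - M <= x <= M) (compact_P3 _ _)
  (fun n => proj1 (Rabs_le_between _ _) (uM n)).
have /choice [s sP] (n : nat) : exists p, (n <= p)%N /\ Rabs (u p - l) <= / INR n.+1.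
  have [|p [/leP np up]] := adh_l (disc l (mkposreal _ (invS_gt0 n))) n.
    by exists (mkposreal _ (invS_gt0 n)).
  by exists p; split=> //; exact: Rlt_le.
exists s, l; split=> [n|]; first by case: (sP n).
by apply: Un_cv_invS => n; case: (sP n).
Qed.

Lemma pt_cv_subsequence u M : (forall n i, Rabs (u n i) <= M) ->
  exists s x, (forall n, (n <= s n)%N) /\ pt_cv (fun n => u (s n)) x.
Proof.
move=> uM; suff subseq k : exists s, (forall n, (n <= s n)%N) /\
    forall i : 'I_d, (i < k)%N -> exists l, Un_cv (fun n => u (s n) i) l.
  have [s [sn us]] := subseq d.
  by have /choice [x ux] i := us i (ltn_ord i); exists s, x.
elim: k => [|k [s [sn us]]]; first by exists id.
case: (ltnP k d) => kd; last first.
  by exists s; split=> // i _; apply: us; exact: leq_trans (ltn_ord i) kd.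
have [s' [l [s'n us']]] := bounded_subsequence (fun n => uM (s n) (Ordinal kd)).
exists (fun n => s (s' n)); split=> [n|i]; first exact: leq_trans (s'n n) (sn _).
rewrite ltnS leq_eqVlt => /orP [/eqP ik|/us [l' ul']].
  by exists l; have -> : i = Ordinal kd by exact: val_inj.
by exists l'; apply: (Un_cv_subseq (u := fun n => u (s n) i)).
Qed.

Definition uniformly_continuous f := forall eps, 0 < eps -> exists del, 0 < del /\
  forall x y, within del x y -> Cnorm (f x - f y) <= eps.

Lemma Cc_uniformly_continuous f : Cc f -> uniformly_continuous f.
Proof.
move=> [/Ccont_seqP cf [M sf]] eps eps0; apply: contrapT => nuc.
have /choice [p pP] (n : nat) : exists p : Pt d * Pt d,
    within (/ INR n.+1) p.1 p.2 /\ eps < Cnorm (f p.1 - f p.2).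
  apply: contrapT => np; apply: nuc; exists (/ INR n.+1); split=> [|x y xy]; first exact: invS_gt0.
  by apply: Rnot_lt_le => fxy; apply: np; exists (x, y).
have p1M n i : Rabs ((p n).1 i) <= M + 1.
  apply: Rnot_lt_le => far; have [close] := pP n.
  have := Rabs_triang ((p n).1 i - (p n).2 i) ((p n).2 i).
  rewrite (_ : (p n).1 i - (p n).2 i + (p n).2 i = (p n).1 i); last by ring.
  have := close i; have := invS_le1 n => inv1 pi triang.
  rewrite (sf (p n).1 i) ?(sf (p n).2 i); [|lra|lra].
  by rewrite (_ : (0 - 0 = 0)%C) ?Cnorm0; [lra | ring].
have [s [x [sn p1x]]] := pt_cv_subsequence (u := fun n => (p n).1) p1M.
have p2x : pt_cv (fun n => (p (s n)).2) x.
  move=> i; have diff0 : Un_cv (fun n => (p n).1 i - (p n).2 i) 0.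
    by apply: Un_cv_invS => n; rewrite Rminus_0_r; case: (pP n).
  have := CV_minus _ _ _ _ (p1x i) (Un_cv_subseq sn diff0); rewrite Rminus_0_r.
  by move/(subst_eqfun (P := Un_cv^~ _)); apply=> n; ring.
have /CvP /(_ eps eps0) [N fN] := CvB (cf _ _ p1x) (cf _ _ p2x).
have [_] := pP (s N); have /= := fN N (leqnn N).
by rewrite (_ : (_ - _ - _ = f (p (s N)).1 - f (p (s N)).2)%C); [lra | ring].
Qed.

Lemma Cc_bounded f : Cc f -> exists B, 0 <= B /\ forall x, Cnorm (f x) <= B.
Proof.
move=> [/Ccont_seqP cf [M sf]]; apply: contrapT => nb.
have /choice [u uP] (n : nat) : exists x, INR n < Cnorm (f x).
  apply: contrapT => nx; apply: nb; exists (INR n); split=> [|x]; first exact: pos_INR.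
  by apply: Rnot_lt_le => fx; apply: nx; exists x.
have uM n i : Rabs (u n i) <= M.
  apply: (box_supp_neq0 sf) => fu0; have := uP n; rewrite fu0 Cnorm0.
  by have := pos_INR n; lra.
have [s [x [sn ux]]] := pt_cv_subsequence uM.
have /CvP /(_ 1 Rlt_0_1) [N fN] := cf _ _ ux.
have [K K_large] := INR_unbounded (Cnorm (f x) + 1).
have := fN (maxn N K) (leq_maxl _ _); have := uP (s (maxn N K)).
have : INR K <= INR (s (maxn N K)) by apply/le_INR/leP/(leq_trans _ (sn _)); exact: leq_maxr.
have := Cnorm_triangle (f (u (s (maxn N K))) - f x)%C (f x).
by rewrite (_ : (_ - _ + _ = f (u (s (maxn N K))))%C); [lra | ring].
Qed.

End CompactSupport.

(** * Sums over lattices *)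

Section Lattice.
Variable d : nat.
Notation idx := {ffun 'I_d -> Z}.
Implicit Types (F : idx -> Cplx) (g : Fn d) (k p q r : idx).

(* [0] if the support of [F] is infinite. *)
Definition lattice_sum F : Cplx := \big[Cadd/C0]_(k \in [set: idx]%classic) F k.

Lemma lattice_sum_seq s F : uniq s -> (forall k, F k <> C0 -> k \in s) ->
  lattice_sum F = (\sum_(k <- s) F k)%C.
Proof.
move=> us supp; rewrite fsbig_seq //; apply: esym; apply: fsbig_widen => // k [_ /= ks].
by apply: contrapT => /supp.
Qed.

Lemma lattice_sumZ (s : seq idx) z F : uniq s -> (forall k, F k <> C0 -> k \in s) ->
  lattice_sum (fun k => z * F k)%C = (z * lattice_sum F)%C.
Proof.
move=> us supp; rewrite (lattice_sum_seq us supp) Cmul_sumr; apply: lattice_sum_seq => // k zF.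
by apply: supp => Fk; apply: zF; rewrite Fk; ring.
Qed.

Definition cube (a : Z) (L : nat) : seq idx :=
  [seq [ffun i => (a + Z.of_nat (r i))%Z] | r : {ffun 'I_d -> 'I_L}].

Lemma mem_cube a L k : (k \in cube a L) <-> (forall i, (a <= k i < a + Z.of_nat L)%Z).
Proof.
split=> [/fintype.imageP [r _ ->] i|kaL]; first by rewrite ffunE; case: (r i) => x /= /ltP; lia.
have kL i : (Z.to_nat (k i - a) < L)%N by apply/ltP; have := kaL i; lia.
apply/fintype.imageP; exists [ffun i => Ordinal (kL i)] => //.
by apply/ffunP => i; rewrite !ffunE /= Z2Nat.id; have := kaL i; lia.
Qed.

Lemma uniq_cube a L : uniq (cube a L).
Proof.
rewrite map_inj_uniq ?enum_uniq // => r r' /ffunP rr'.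
apply/ffunP => i; apply: val_inj; have := rr' i; rewrite !ffunE => e /=.
by apply: Nat2Z.inj; lia.
Qed.

Lemma size_cube a L : INR (size (cube a L)) = INR L ^ d.
Proof.
rewrite size_image card_ffun !card_ord.
by elim: (d) => [//|n IH]; rewrite expnS mult_INR IH.
Qed.

Definition subdivide (L : nat) q r : idx := [ffun i => (Z.of_nat L * q i + r i)%Z].

Lemma subdivide_uniq L (s : seq idx) : uniq s -> uniq [seq subdivide L q r | q <- s, r <- cube 0 L].
Proof.
move=> us; apply: allpairs_uniq => //; first exact: uniq_cube.
move=> _ _ /allpairsP [[q r] [_ /mem_cube rL ->]] /allpairsP [[q' r'] [_ /mem_cube r'L ->]].
move=> /= /ffunP qr; suff eqs i : q i = q' i /\ r i = r' i.
  by congr pair; apply/ffunP => i; case: (eqs i).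
have := qr i; rewrite !ffunE; apply: (Z.div_mod_unique (Z.of_nat L)); left.
  exact: rL.
exact: r'L.
Qed.

Lemma lattice_sum_subdivide L (s : seq idx) F : (0 < L)%N -> (forall k, F k <> C0 -> k \in s) ->
  lattice_sum F = lattice_sum (fun q => \sum_(r <- cube 0 L) F (subdivide L q r))%C.
Proof.
move=> L0 supp; have Lpos : (0 < Z.of_nat L)%Z by move/ltP: L0; lia.
pose quot k : idx := [ffun i => (k i / Z.of_nat L)%Z].
have supp_quot k : F k <> C0 -> quot k \in undup [seq quot k | k <- s].
  by move=> /supp ks; rewrite mem_undup map_f.
pose Q := undup [seq quot k | k <- s].
rewrite [RHS](@lattice_sum_seq Q) ?undup_uniq //; last first.
  move=> q; apply: contra_notT => nq; rewrite big_seq big1 // => r /mem_cube rL.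
  apply: contrapT => /supp_quot; suff -> : quot (subdivide L q r) = q by rewrite (negbTE nq).
  apply/ffunP => i; rewrite !ffunE Z.mul_comm Z.div_add_l; last by lia.
  by rewrite Z.div_small ?Z.add_0_r //; exact: rL.
rewrite -(big_allpairs_dep (h := subdivide L) (r1 := Q) (r2 := fun=> cube 0 L) (F := F)).
apply: lattice_sum_seq => [|k Fk]; first by apply: subdivide_uniq; exact: undup_uniq.
apply/allpairsP; exists (quot k, [ffun i => (k i mod Z.of_nat L)%Z]); split=> /=.
- exact: supp_quot.
- by apply/mem_cube => i; rewrite ffunE; exact: Z.mod_pos_bound.
- by apply/ffunP => i; rewrite !ffunE; apply: Z.div_mod; lia.
Qed.

Definition grid (N : nat) k : Pt d := fun i => IZR (k i) / INR N.

Definition grid_sum (N : nat) g : Cplx :=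
  ((/ INR N ^ d)%:C * lattice_sum (fun k => g (grid N k)))%C.

Definition radius (M : R) (N : nat) : nat := Z.to_nat (up (M * INR N)).
Definition grid_box (M : R) (N : nat) : seq idx :=
  cube (- Z.of_nat (radius M N)) (2 * radius M N).+1.

Lemma radius_bounds M N : 0 <= M -> M * INR N <= INR (radius M N) <= M * INR N + 1.
Proof.
move=> M0; have [up_gt up_le] := archimed (M * INR N).
have MN0 : 0 <= M * INR N by apply: Rmult_le_pos => //; exact: pos_INR.
have up0 : (0 <= up (M * INR N))%Z by apply: le_IZR; lra.
by rewrite /radius (INR_IZR_INZ (Z.to_nat _)) Z2Nat.id //; lra.
Qed.

Lemma mem_centered_cube n k :
  (forall i, Rabs (IZR (k i)) <= INR n) -> k \in cube (- Z.of_nat n) (2 * n).+1.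
Proof.
move=> kn; apply/mem_cube => i; have := kn i.
rewrite INR_IZR_INZ => /Rabs_le_between []; rewrite -opp_IZR => /le_IZR k_ge /le_IZR k_le.
by rewrite Nat2Z.inj_succ Nat2Z.inj_mul; lia.
Qed.

Lemma Rabs_grid_le M N k i : (0 < N)%N -> Rabs (grid N k i) <= M -> Rabs (IZR (k i)) <= M * INR N.
Proof.
move=> /ltP /lt_0_INR N0 gridM.
have -> : IZR (k i) = grid N k i * INR N by rewrite /grid; field; lra.
by rewrite Rabs_mult (Rabs_pos_eq (INR N)); [apply: Rmult_le_compat_r => //; lra | lra].
Qed.

Lemma box_supp_grid M g N k : (0 < N)%N -> box_supp M g -> g (grid N k) <> C0 ->
  forall i, Rabs (IZR (k i)) <= M * INR N.
Proof. by move=> N0 supp gk i; apply: Rabs_grid_le => //; exact: box_supp_neq0 supp gk i. Qed.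

Lemma mem_grid_box M g N k : (0 < N)%N -> 0 <= M -> box_supp M g -> g (grid N k) <> C0 ->
  k \in grid_box M N.
Proof.
move=> N0 M0 supp gk; apply: mem_centered_cube => i.
apply: Rle_trans (proj1 (radius_bounds N M0)); exact: box_supp_grid supp gk i.
Qed.

Lemma grid_sum_box M N g : (0 < N)%N -> 0 <= M -> box_supp M g ->
  grid_sum N g = ((/ INR N ^ d)%:C * \sum_(k <- grid_box M N) g (grid N k))%C.
Proof.
move=> N0 M0 supp; congr (_ * _)%C; apply: lattice_sum_seq; first exact: uniq_cube.
by move=> k; exact: mem_grid_box.
Qed.

Lemma riemann_sum_grid_sum M g : box_supp M g ->
  exists n0, forall n, (n0 <= n)%N -> riemann_sum g n = grid_sum n.+1 g.
Proof.
move=> supp; have [n0 n0_large] := INR_unbounded (2 * Rabs M + 1).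
exists n0 => n n0n; rewrite /grid_sum.
rewrite (@lattice_sum_seq (cube (- Z.of_nat (n * n)%N) (2 * (n * n)).+1)).
- rewrite /riemann_sum -mulnA -Cmul_sumr; congr (_ * _)%C.
  rewrite /cube big_image_cond /=; apply: eq_bigr => k _; congr g.
  by apply: funext => i; rewrite /grid ffunE plus_IZR opp_IZR -!INR_IZR_INZ; congr (_ / _); ring.
- exact: uniq_cube.
move=> k gk; apply: mem_centered_cube => i; apply: Rle_trans (box_supp_grid _ supp gk i) _ => //.
have := le_INR _ _ (leP n0n); have := Rle_abs M; have := Rabs_pos M.
by rewrite mult_INR S_INR; nra.
Qed.

Lemma grid_sum_lin M N z f g : (0 < N)%N -> 0 <= M -> box_supp M f -> box_supp M g ->
  grid_sum N (fun x => f x + z * g x)%C = (grid_sum N f + z * grid_sum N g)%C.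
Proof.
move=> N0 M0 sf sg; have sfg := box_supp_lin z sf sg.
by rewrite (grid_sum_box N0 M0 sfg) (grid_sum_box N0 M0 sf) (grid_sum_box N0 M0 sg) Csum_lin; ring.
Qed.

Definition box_volume (M : R) : R := (2 * M + 3) ^ d.

Lemma box_volume_gt0 M : 0 <= M -> 0 < box_volume M.
Proof. by move=> M0; apply: pow_lt; lra. Qed.

Lemma grid_box_volume M N : (0 < N)%N -> 0 <= M ->
  / INR N ^ d * INR (size (grid_box M N)) <= box_volume M.
Proof.
move=> N0 M0; have N1 : 1 <= INR N by apply: (le_INR 1); apply/leP.
have invN : 0 < / INR N by apply: Rinv_0_lt_compat; lra.
rewrite size_cube -pow_inv -Rpow_mult_distr.
have [_ radius_le] := radius_bounds N M0.
apply: pow_incr; split; first by apply: Rmult_le_pos; [lra | exact: pos_INR].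
apply: (Rmult_le_reg_l (INR N)); first lra.
by rewrite -Rmult_assoc Rinv_r; [rewrite S_INR mult_INR [INR 2]/=; nra | lra].
Qed.

Lemma grid_sum_bound M N g B : (0 < N)%N -> 0 <= M -> box_supp M g ->
  (forall x, Cnorm (g x) <= B) -> Cnorm (grid_sum N g) <= B * box_volume M.
Proof.
move=> N0 M0 supp gB; have B0 : 0 <= B := Rle_trans _ _ _ (Cnorm_ge0 _) (gB 0%V).
have invNd : 0 < / INR N ^ d by apply/Rinv_0_lt_compat/pow_lt/lt_0_INR/ltP.
rewrite (grid_sum_box N0 M0 supp) CnormM Cnorm_RtoC (Rabs_pos_eq _ (Rlt_le _ _ invNd)).
have sum_le : Cnorm (\sum_(k <- grid_box M N) g (grid N k)) <= INR (size (grid_box M N)) * B.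
  by apply: Cnorm_sum_le => k _; exact: gB.
apply: Rle_trans (Rmult_le_compat_l _ _ _ (Rlt_le _ _ invNd) sum_le) _.
by rewrite -Rmult_assoc Rmult_comm; apply: Rmult_le_compat_l => //; exact: grid_box_volume.
Qed.

Lemma grid_sum_shift N g p : (0 < N)%N -> grid_sum N (fun x => g (x + grid N p)%V) = grid_sum N g.
Proof.
move=> /ltP /lt_0_INR N0; congr (_ * _)%C.
pose sh k : idx := [ffun i => (k i + p i)%Z]; pose unsh k : idx := [ffun i => (k i - p i)%Z].
have bij_sh : bijective sh.
  exists unsh => k; apply/ffunP => i; rewrite !ffunE; [exact: Z.add_simpl_r | exact: Z.sub_add].
rewrite /lattice_sum [RHS](reindex_fsbigT sh _ bij_sh); apply: eq_fsbigr => k _; congr g.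
by apply: funext => i; rewrite /vadd /grid ffunE plus_IZR; field; lra.
Qed.

Lemma grid_sum_opp N g : (0 < N)%N -> grid_sum N (fun x => g (- x)%V) = grid_sum N g.
Proof.
move=> /ltP /lt_0_INR N0; congr (_ * _)%C.
pose op k : idx := [ffun i => (- k i)%Z].
have bij_op : bijective op.
  by exists op => k; apply/ffunP => i; rewrite !ffunE Z.opp_involutive.
rewrite /lattice_sum [RHS](reindex_fsbigT op _ bij_op); apply: eq_fsbigr => k _; congr g.
by apply: funext => i; rewrite /vscal /grid ffunE opp_IZR; field; lra.
Qed.

Definition subgrid_mean (N L : nat) g : Fn d := fun x =>
  ((/ INR L ^ d)%:C * \sum_(r <- cube 0 L) g (x + grid (N * L) r)%V)%C.

Lemma grid_sum_subgrid_mean M N L g : (0 < N)%N -> (0 < L)%N -> 0 <= M -> box_supp M g ->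
  grid_sum (N * L) g = grid_sum N (subgrid_mean N L g).
Proof.
move=> N0 L0 M0 supp; have NL0 : (0 < N * L)%N by rewrite muln_gt0 N0.
have [INRN INRL] : 0 < INR N /\ 0 < INR L by split; apply/lt_0_INR/ltP.
have gridE q r : (grid N q + grid (N * L) r)%V = grid (N * L) (subdivide L q r).
  apply: funext => i; rewrite /vadd /grid ffunE plus_IZR mult_IZR mult_INR -INR_IZR_INZ.
  by field; lra.
have supp_box k : g (grid (N * L) k) <> C0 -> k \in grid_box M (N * L) by exact: mem_grid_box.
rewrite /grid_sum mult_INR Rpow_mult_distr Rinv_mult RtoCM -CmulA; congr (_ * _)%C.
rewrite -(lattice_sumZ _ (uniq_cube _ _) supp_box).
rewrite (lattice_sum_subdivide (s := grid_box M (N * L)) L0).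
  congr lattice_sum; apply: funext => q; rewrite /subgrid_mean Cmul_sumr.
  by under eq_bigr do rewrite -gridE.
by move=> k zg; apply: supp_box => gk; apply: zg; rewrite gk; ring.
Qed.

Lemma grid_cube0_le N L r : (0 < N)%N -> (0 < L)%N -> r \in cube 0 L ->
  forall i, Rabs (grid (N * L) r i) <= / INR N.
Proof.
move=> N0 L0 /mem_cube rL i; have [r_ge0 r_ltL] := rL i.
have [INRN INRL] : 0 < INR N /\ 0 < INR L by split; apply/lt_0_INR/ltP.
have r0 : 0 <= IZR (r i) by exact: IZR_le.
have rL' : IZR (r i) <= INR L by rewrite INR_IZR_INZ; apply: IZR_le; lia.
have -> : grid (N * L) r i = IZR (r i) / INR L * / INR N.
  by rewrite /grid mult_INR; field; lra.
have frac : 0 <= IZR (r i) / INR L <= 1.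
  by split; [apply/Rle_div_r | apply/Rle_div_l]; lra.
have invN := Rinv_0_lt_compat _ INRN; set x := IZR (r i) / INR L in frac *.
by rewrite Rabs_pos_eq; nra.
Qed.

Lemma subgrid_mean_close N L g eps : (0 < N)%N -> (0 < L)%N ->
  (forall x y, within (/ INR N) x y -> Cnorm (g x - g y) <= eps) ->
  forall x, Cnorm (subgrid_mean N L g x - g x) <= eps.
Proof.
move=> N0 L0 osc x; have Ld0 : 0 < INR L ^ d by apply/pow_lt/lt_0_INR/ltP.
have -> : (subgrid_mean N L g x - g x =
    (/ INR L ^ d)%:C * \sum_(r <- cube 0 L) (g (x + grid (N * L) r)%V - g x))%C.
  have one : ((/ INR L ^ d)%:C * (INR L ^ d)%:C = 1)%C by rewrite -RtoCM Rinv_l //; lra.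
  rewrite /subgrid_mean CsumB Csum_const size_cube -[g x in LHS]Cmul1z -one.
  by ring.
have invLd := Rinv_0_lt_compat _ Ld0; rewrite CnormM Cnorm_RtoC (Rabs_pos_eq (/ _)); last lra.
have sum_le : Cnorm (\sum_(r <- cube 0 L) (g (x + grid (N * L) r)%V - g x)) <= INR L ^ d * eps.
  rewrite -(size_cube 0); apply: Cnorm_sum_le => r rL; apply: osc => i.
  have -> : (x + grid (N * L) r)%V i - x i = grid (N * L) r i by rewrite /vadd; ring.
  exact: grid_cube0_le.
apply: Rle_trans (Rmult_le_compat_l _ _ _ (Rlt_le _ _ invLd) sum_le) _.
by rewrite -Rmult_assoc Rinv_l; lra.
Qed.

Lemma box_supp_subgrid_mean M N L g : (0 < N)%N -> (0 < L)%N -> box_supp M g ->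
  box_supp (M + 1) (subgrid_mean N L g).
Proof.
move=> N0 L0 supp x i xi; rewrite /subgrid_mean big_seq big1 => [|r rL]; first by ring.
apply: (box_supp_shift (M' := 1) _ supp xi) => j; apply: Rle_trans (grid_cube0_le N0 L0 rL j) _.
by case: N N0 => // N _; exact: invS_le1.
Qed.

Lemma subgrid_mean_Re_ge0 N L g :
  (forall x, 0 <= fst (g x)) -> forall x, 0 <= fst (subgrid_mean N L g x).
Proof.
move=> g_ge0 x; rewrite /subgrid_mean /Cmul /= Rmult_0_l Rminus_0_r fst_sum.
apply: Rmult_le_pos; last by apply: Rsum_ge0 => r; exact: g_ge0.
rewrite -pow_inv; apply: pow_le; case: L => [|L]; first by rewrite Rinv_0; lra.
exact/Rlt_le/invS_gt0.
Qed.

Lemma grid_sum_refine M N L g eps : (0 < N)%N -> (0 < L)%N -> 0 <= M -> box_supp M g ->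
  (forall x y, within (/ INR N) x y -> Cnorm (g x - g y) <= eps) ->
  Cnorm (grid_sum (N * L) g - grid_sum N g) <= eps * box_volume (M + 1).
Proof.
move=> N0 L0 M0 supp osc; have M1 : 0 <= M + 1 by lra.
have supp1 : box_supp (M + 1) g by apply: box_supp_le supp; lra.
have suppm := box_supp_subgrid_mean N0 L0 supp.
rewrite (grid_sum_subgrid_mean N0 L0 M0 supp) CsubE -(grid_sum_lin _ N0 M1 suppm supp1).
apply: grid_sum_bound => // [|x]; first exact: box_supp_lin.
by rewrite -CsubE; exact: subgrid_mean_close.
Qed.

Lemma grid_sum_Re_ge N g M : (0 < N)%N -> 0 <= M -> box_supp M g -> (forall x, 0 <= fst (g x)) ->
  / INR N ^ d * fst (g 0%V) <= fst (grid_sum N g).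
Proof.
move=> N0 M0 supp g_ge0; have invNd : 0 < / INR N ^ d by apply/Rinv_0_lt_compat/pow_lt/lt_0_INR/ltP.
rewrite (grid_sum_box N0 M0 supp) /Cmul /= Rmult_0_l Rminus_0_r fst_sum.
apply: Rmult_le_compat_l; first lra.
have origin : [ffun=> 0%Z] \in grid_box M N.
  by apply: mem_centered_cube => i; rewrite ffunE Rabs_R0; exact: pos_INR.
rewrite (bigD1_seq _ origin (uniq_cube _ _)) /= (_ : grid N _ = 0%V); last first.
  by apply: funext => i; rewrite /grid ffunE /Rdiv Rmult_0_l.
set rest := (X in _ <= _ + X); have : 0 <= rest by apply: Rsum_ge0 => k; exact: g_ge0.
by lra.
Qed.

End Lattice.

(** * The integral *)

Section Integral.
Variable d : nat.
Implicit Types f g : Fn d.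

Lemma grid_sum_Cauchy g : Cc g -> exists l, Cv (fun n => grid_sum n.+1 g) l.
Proof.
move=> ccg; have [M [M0 supp]] := Cc_supp ccg; apply: Cauchy_Cv => eps eps0.
pose vol := box_volume d (M + 1); have vol0 : 0 < vol by apply: box_volume_gt0; lra.
have e0 : 0 < eps / (3 * vol) by apply: Rdiv_lt_0_compat; lra.
have [del [del0 osc]] := Cc_uniformly_continuous ccg e0.
have [N inv_small] := invS_small del0.
have refine n m : (N <= n)%N ->
    Cnorm (grid_sum (n.+1 * m.+1) g - grid_sum n.+1 g) <= eps / 3.
  move=> Nn; have -> : eps / 3 = eps / (3 * vol) * vol by field; lra.
  apply: grid_sum_refine => // x y xy; apply: osc => i.
  exact: Rle_trans (xy i) (Rlt_le _ _ (inv_small n Nn)).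
exists N => n m Nn Nm; have := refine n m Nn; have := refine m n Nm; rewrite mulnC.
have := Cnorm_sub_triangle (grid_sum n.+1 g) (grid_sum (n.+1 * m.+1) g) (grid_sum m.+1 g).
by rewrite (Cnorm_subC (grid_sum n.+1 g) (grid_sum (n.+1 * m.+1) g)); lra.
Qed.

(* [0] if the Riemann sums diverge. *)
Definition integral g : Cplx := xget C0 [set l | Cv (riemann_sum g) l]%classic.

Lemma integral_riemann g : Cc g -> Cv (riemann_sum g) (integral g).
Proof.
move=> ccg; have [M [_ supp]] := Cc_supp ccg.
have [l cv_l] := grid_sum_Cauchy ccg; have [N sumE] := riemann_sum_grid_sum supp.
apply: (xgetPex C0 (P := [set l | Cv (riemann_sum g) l]%classic)); exists l.
exact: Cv_eventually (fun n Nn => esym (sumE n Nn)) cv_l.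
Qed.

Lemma integral_grid_sum g : Cc g -> Cv (fun n => grid_sum n.+1 g) (integral g).
Proof.
move=> ccg; have [M [_ supp]] := Cc_supp ccg; have [N sumE] := riemann_sum_grid_sum supp.
exact: Cv_eventually sumE (integral_riemann ccg).
Qed.

Lemma integral_grid_sum_multiples N g : (0 < N)%N -> Cc g ->
  Cv (fun n => grid_sum (N * n.+1) g) (integral g).
Proof.
move=> N0 ccg; have mono n : (n <= (N * n.+1).-1)%N.
  by case: N N0 => // N _; rewrite mulSn addSn /= leq_addr.
apply: Cv_ext (Cv_subseq mono (integral_grid_sum ccg)) _ => n.
by rewrite prednK // muln_gt0 N0.
Qed.

Lemma integral_error M N g eps : (0 < N)%N -> 0 <= M -> Cc g -> box_supp M g ->
  (forall x y, within (/ INR N) x y -> Cnorm (g x - g y) <= eps) ->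
  Cnorm (integral g - grid_sum N g) <= eps * box_volume d (M + 1).
Proof.
move=> N0 M0 ccg supp osc; apply: Cnorm_lim_le (integral_grid_sum_multiples N0 ccg) _ => n.
exact: grid_sum_refine.
Qed.

Lemma integral_lin f g z : Cc f -> Cc g ->
  integral (fun x => f x + z * g x)%C = (integral f + z * integral g)%C.
Proof.
move=> ccf ccg; have [M [M0 [sf sg]]] := common_box_supp ccf ccg.
apply: Cv_unique (integral_grid_sum (Cc_lin z ccf ccg)) _.
have := CvD (integral_grid_sum ccf) (CvM (Cv_const z) (integral_grid_sum ccg)).
by move/Cv_ext; apply=> n; rewrite (grid_sum_lin z _ M0 sf sg).
Qed.

Lemma integral0 : integral (fun=> C0) = C0.
Proof.
have [cc0 _] := Cc_subspace d; have := integral_lin (- 1) cc0 cc0.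
by rewrite (_ : (fun _ => _) = fun=> C0) => [->|]; [ring | apply: funext => x; ring].
Qed.

Lemma integralB f g : Cc f -> Cc g -> integral (fun x => f x - g x)%C = (integral f - integral g)%C.
Proof.
by move=> ccf ccg; rewrite CsubE -integral_lin //; congr integral; apply: funext => x; ring.
Qed.

Lemma integral_sum (I : Type) (r : seq I) (F : I -> Fn d) (c : I -> Cplx) : (forall i, Cc (F i)) ->
  integral (fun x => \sum_(i <- r) (c i * F i x))%C = (\sum_(i <- r) (c i * integral (F i)))%C.
Proof.
move=> ccF; elim: r => [|i r IH].
  rewrite big_nil -[RHS]integral0; congr integral.
  by apply: funext => x; rewrite big_nil.
rewrite big_cons -IH CaddC -integral_lin //; last first.
  by apply: subspace_sum (Cc_subspace d) _ => j _; apply: subspaceZ (Cc_subspace d) (ccF j).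
by congr integral; apply: funext => x; rewrite big_cons CaddC.
Qed.

Lemma integral_bound M g B : 0 <= M -> Cc g -> box_supp M g -> (forall x, Cnorm (g x) <= B) ->
  Cnorm (integral g) <= B * box_volume d M.
Proof.
move=> M0 ccg supp gB.
rewrite -(Csubz0 (integral g)); apply: Cnorm_lim_le (integral_grid_sum ccg) _ => n.
by rewrite Csubz0; exact: grid_sum_bound.
Qed.

Lemma integral_opp g : Cc g -> integral (fun x => g (- x)%V) = integral g.
Proof.
move=> ccg; apply: Cv_unique (integral_grid_sum ccg).
have ccNg : Cc (fun x => g (- x)%V).
  have [cg [M supp]] := ccg; split.
    by apply: subst_eqfun (Ccont_affine (-1) 0%V cg) _ => x; rewrite vaddx0.
  exists M => x i xi; apply: (supp _ i).
  by rewrite /vscal Rabs_mult Rabs_Ropp Rabs_R1 Rmult_1_l.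
apply: Cv_ext (integral_grid_sum ccNg) _ => n.
by rewrite grid_sum_opp.
Qed.

Lemma grid_approximation (a : Pt d) n : exists p, within (/ INR n.+1) (grid n.+1 p) a.
Proof.
exists [ffun i => up (a i * INR n.+1)] => i; rewrite /grid ffunE.
have [up_gt up_le] := archimed (a i * INR n.+1); have inv0 := invS_gt0 n.
have N0 : 0 < INR n.+1 by apply: lt_0_INR; lia.
have -> : IZR (up (a i * INR n.+1)) / INR n.+1 - a i =
    (IZR (up (a i * INR n.+1)) - a i * INR n.+1) * / INR n.+1 by field; lra.
by rewrite Rabs_pos_eq; nra.
Qed.

(* Riemann sums are exactly invariant under grid vectors, and these approximate [a]. *)
Lemma integral_shift g a : Cc g -> integral (fun x => g (x + a)%V) = integral g.
Proof.
move=> ccg; have [M [M0 supp]] := Cc_supp ccg; have cca := Cc_shift a ccg.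
apply: Csub_eq0; apply: Cnorm_eq0; apply: Rle_antisym (Cnorm_ge0 _).
apply: le_epsilon => eps eps0; rewrite Rplus_0_l.
pose M' := M + (vnorm a + 1); have M'0 : 0 <= M' by rewrite /M'; have := vnorm_ge0 a; lra.
have vol0 := box_volume_gt0 d M'0.
have [del [del0 osc]] := Cc_uniformly_continuous ccg (Rdiv_lt_0_compat _ _ eps0 vol0).
have [N inv_small] := invS_small del0.
have shifts := Cv_subseq (leq_addl N) (CvB (integral_grid_sum cca) (integral_grid_sum ccg)).
rewrite -[X in Cnorm X]Csubz0; apply: Cnorm_lim_le shifts _ => n; rewrite Csubz0.
have [p pa] := grid_approximation a (N + n); rewrite -(grid_sum_shift g p) //.
have supp_shift y : (forall i, Rabs (y i) <= vnorm a + 1) -> box_supp M' (fun x => g (x + y)%V).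
  by move=> ya; exact: box_supp_shift supp.
have suppa : box_supp M' (fun x => g (x + a)%V).
  by apply: supp_shift => i; have := Rabs_coord_le_vnorm a i; lra.
have suppp : box_supp M' (fun x => g (x + grid (N + n).+1 p)%V).
  apply: supp_shift => i; have := pa i; have := invS_le1 (N + n); have := Rabs_coord_le_vnorm a i.
  have := Rabs_triang (grid (N + n).+1 p i - a i) (a i).
  by rewrite (_ : _ - _ + _ = grid (N + n).+1 p i); [lra | ring].
rewrite CsubE -(grid_sum_lin _ _ M'0 suppa suppp) //.
have -> : eps = eps / box_volume d M' * box_volume d M' by field; lra.
apply: grid_sum_bound => // [|x]; first exact: box_supp_lin.
rewrite -CsubE; apply: osc => i; have -> : (x + a)%V i - (x + grid (N + n).+1 p)%V i =
    - (grid (N + n).+1 p i - a i) by rewrite /vadd; ring.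
by rewrite Rabs_Ropp; apply: Rle_trans (pa i) (Rlt_le _ _ (inv_small _ (leq_addr _ _))).
Qed.

Lemma integral_eq0_origin g :
  Cc g -> (forall x, 0 <= fst (g x)) -> integral g = C0 -> fst (g 0%V) = 0.
Proof.
move=> ccg g_ge0 int0; apply: contrapT => g0.
have g_gt0 : 0 < fst (g 0%V) by have := g_ge0 0%V; lra.
have [M [M0 supp]] := Cc_supp ccg; have half0 : 0 < fst (g 0%V) / 2 by lra.
have [del [del0 osc]] := Cc_uniformly_continuous ccg half0.
have [N0 inv_small] := invS_small del0; pose N := N0.+1.
have close L x : Cnorm (subgrid_mean N L.+1 g x - g x) <= fst (g 0%V) / 2.
  apply: subgrid_mean_close => // y z yz; apply: osc => i.
  exact: Rle_trans (yz i) (Rlt_le _ _ (inv_small _ (leqnn _))).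
pose c := / INR N ^ d * (fst (g 0%V) / 2).
have c0 : 0 < c by apply: Rmult_lt_0_compat => //; apply/Rinv_0_lt_compat/pow_lt/lt_0_INR; lia.
have sum_ge n : c <= fst (grid_sum (N * n.+1) g).
  rewrite (grid_sum_subgrid_mean (M := M)) //.
  have supp1 := box_supp_subgrid_mean (ltn0Sn N0) (ltn0Sn n) supp.
  have M1 : 0 <= M + 1 by lra.
  apply: Rle_trans (grid_sum_Re_ge (ltn0Sn N0) M1 supp1 (subgrid_mean_Re_ge0 _ _ g_ge0)).
  apply: Rmult_le_compat_l; first exact/Rlt_le/Rinv_0_lt_compat/pow_lt/lt_0_INR/ltP.
  have fstB z w : fst (z - w)%C = fst z - fst w by [].
  have /Rabs_le_between := Rle_trans _ _ _ (Rabs_fst_le _) (close n 0%V).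
  by rewrite fstB /N; lra.
have /CvP /(_ c c0) [n sum_lt] := integral_grid_sum_multiples (ltn0Sn N0 : (0 < N)%N) ccg.
have := sum_lt n (leqnn n); rewrite int0 Csubz0; have := Rabs_fst_le (grid_sum (N * n.+1) g).
by have := sum_ge n; have := Rle_abs (fst (grid_sum (N * n.+1) g)); lra.
Qed.

Lemma integral_eq0 g x : Cc g -> (forall y, 0 <= fst (g y)) -> integral g = C0 -> fst (g x) = 0.
Proof.
move=> ccg g_ge0 int0; have := integral_eq0_origin (Cc_shift x ccg) (fun y => g_ge0 (y + x)%V).
by rewrite integral_shift // vadd0x; apply.
Qed.

End Integral.

(** * Smooth functions and test functions *)

Lemma cderiv_locally_ext f g t l e : 0 < e -> (forall s, Rabs (s - t) < e -> f s = g s) ->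
  cderiv f t l -> cderiv g t l.
Proof.
move=> e0 fg; have te : t - e < t < t + e by lra.
have fg' s : t - e < s < t + e -> f s = g s by move=> ts; apply/fg/Rabs_def1; lra.
by move=> [df1 df2]; split; [apply: derivable_pt_lim_locally_ext te _ df1 |
  apply: derivable_pt_lim_locally_ext te _ df2] => s /fg' ->.
Qed.

Lemma cderiv_conj f t l : cderiv f t l -> cderiv (fun s => Cconj (f s)) t (Cconj l).
Proof. by move=> [? ?]; split=> //; exact: derivable_pt_lim_opp. Qed.

Lemma mean_value_bound_real (f f' : R -> R) h l e : (forall s, derivable_pt_lim f s (f' s)) ->
  (forall s, Rabs s <= Rabs h -> Rabs (f' s - l) <= e) -> Rabs (f h - f 0 - h * l) <= e * Rabs h.
Proof.
move=> df f'l; have [c [ch ->]] := MVT_gen f 0 h f'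
  (fun s _ => proj2 (is_derive_Reals _ _ _) (df s))
  (fun s _ => derivable_continuous_pt _ _ (exist _ _ (df s))).
have -> : f' c * (h - 0) - h * l = (f' c - l) * h by ring.
rewrite Rabs_mult; apply: Rmult_le_compat_r; first exact: Rabs_pos.
apply: f'l; move: ch; rewrite /Rmin /Rmax; case: Rle_dec => h0 c_between.
  by rewrite !Rabs_pos_eq; lra.
by rewrite !Rabs_left1; lra.
Qed.

Lemma mean_value_bound f f' h l e : (forall s, cderiv f s (f' s)) ->
  (forall s, Rabs s <= Rabs h -> Cnorm (f' s - l) <= e) ->
  Cnorm (f h - f 0%R - h%:C * l) <= 2 * e * Rabs h.
Proof.
move=> df f'l; apply: Rle_trans (Cnorm_le_sum _) _.
have fst_le := mean_value_bound_real (fun s => proj1 (df s))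
  (fun s sh => Rle_trans _ _ _ (Rabs_fst_le (f' s - l)%C) (f'l s sh)).
have snd_le := mean_value_bound_real (fun s => proj2 (df s))
  (fun s sh => Rle_trans _ _ _ (Rabs_snd_le (f' s - l)%C) (f'l s sh)).
have -> : fst (f h - f 0%R - h%:C * l)%C = fst (f h) - fst (f 0) - h * fst l by rewrite /=; ring.
have -> : snd (f h - f 0%R - h%:C * l)%C = snd (f h) - snd (f 0) - h * snd l by rewrite /=; ring.
by lra.
Qed.

Lemma cderiv_of_estimate (f : R -> Cplx) l :
  (forall eps, 0 < eps -> exists del, 0 < del /\ forall s, Rabs s <= del ->
    Cnorm (f s - f 0%R - s%:C * l) <= eps * Rabs s) -> cderiv f 0 l.
Proof.
move=> est; have component (pr : Cplx -> R) : (forall s, pr (f s) - pr (f 0) - s * pr l =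
    pr (f s - f 0%R - s%:C * l)%C) -> (forall z, Rabs (pr z) <= Cnorm z) ->
    derivable_pt_lim (fun s => pr (f s)) 0 (pr l).
  move=> prE pr_le eps eps0; have [del [del0 fdel]] := est (eps / 2) ltac:(lra).
  exists (mkposreal del del0) => s s0 /= sdel; rewrite Rplus_0_l.
  have abs_s : 0 < Rabs s by exact: Rabs_pos_lt.
  have := Rle_trans _ _ _ (pr_le _) (fdel s (Rlt_le _ _ sdel)); rewrite -prE => pr_s.
  have -> : (pr (f s) - pr (f 0)) / s - pr l = (pr (f s) - pr (f 0) - s * pr l) / s by field.
  by rewrite Rabs_div //; apply/Rlt_div_l => //; nra.
split; [apply: (component fst) | apply: (component snd)] => // [s||s|]; try by rewrite /=; ring.
  exact: Rabs_fst_le.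
exact: Rabs_snd_le.
Qed.

Section Smooth.
Variable d : nat.
Implicit Types f g : Fn d.

Lemma has_partialE i f g :
  has_partial i f g <-> forall x, cderiv (fun s => f (x + s *: unit_vec i)%V) 0 (g x).
Proof. by []. Qed.

Lemma vadd_scal0 (x v : Pt d) : (x + 0%R *: v)%V = x.
Proof. by pt_ring. Qed.

Lemma has_partial_const i z : has_partial i (fun _ : Pt d => z) (fun=> C0).
Proof. by apply/has_partialE => x; exact: cderiv_const. Qed.

Lemma has_partial_lin i f f' g g' z : has_partial i f f' -> has_partial i g g' ->
  has_partial i (fun x => f x + z * g x)%C (fun x => f' x + z * g' x)%C.
Proof.
by move=> df dg; apply/has_partialE => x; apply: cderivD (df x) _; exact: cderivZ (dg x).
Qed.

Lemma has_partialD i f f' g g' : has_partial i f f' -> has_partial i g g' ->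
  has_partial i (fun x => f x + g x)%C (fun x => f' x + g' x)%C.
Proof. by move=> df dg; apply/has_partialE => x; apply: cderivD (df x) (dg x). Qed.

Lemma has_partialM i f f' g g' : has_partial i f f' -> has_partial i g g' ->
  has_partial i (fun x => f x * g x)%C (fun x => f' x * g x + f x * g' x)%C.
Proof.
move=> df dg; apply/has_partialE => x.
by apply: cderiv_ext (cderivM (df x) (dg x)) _ _ => //; rewrite vadd_scal0.
Qed.

Lemma has_partial_shift i f f' y : has_partial i f f' ->
  has_partial i (fun x => f (x + y)%V) (fun x => f' (x + y)%V).
Proof.
move=> df; apply/has_partialE => x; apply: cderiv_ext (df (x + y)%V) _ _ => // s.
by congr f; pt_ring.
Qed.

Lemma has_partial_conj i f f' : has_partial i f f' ->
  has_partial i (fun x => Cconj (f x)) (fun x => Cconj (f' x)).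
Proof. by move=> df; apply/has_partialE => x; exact: cderiv_conj (df x). Qed.

Lemma has_partial_line i f f' x t : has_partial i f f' ->
  cderiv (fun s => f (x + s *: unit_vec i)%V) t (f' (x + t *: unit_vec i)%V).
Proof.
move=> df; pose k s := f (x + t *: unit_vec i + s *: unit_vec i)%V.
have := df (x + t *: unit_vec i)%V; rewrite -(Rplus_opp_r t) => /(cderiv_shift (f := k)).
by move/cderiv_ext; apply=> // s; congr f; pt_ring.
Qed.

Lemma has_partial_box_supp M i f f' : box_supp M f -> has_partial i f f' -> box_supp M f'.
Proof.
move=> supp df x j xj; apply: cderiv_unique (df x) _.
have e0 : 0 < Rabs (x j) - M by lra.
apply: (cderiv_locally_ext (f := fun=> C0) e0) => [s|]; last exact: cderiv_const.
rewrite Rminus_0_r => s_small; apply: esym; apply: (supp _ j).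
have := Rabs_scal_unit_vec_le i j s; rewrite /vadd /vscal => si_le.
have := Rabs_triang (x j + s * unit_vec i j) (- (s * unit_vec i j)).
by rewrite Rabs_Ropp (_ : _ + _ + - _ = x j); [lra | ring].
Qed.

Lemma uniform_difference_quotient i g g' : Cc g' -> has_partial i g g' ->
  forall eps, 0 < eps -> exists del, 0 < del /\ forall s x, Rabs s <= del ->
    Cnorm (g (x + s *: unit_vec i)%V - g x - s%:C * g' x) <= eps * Rabs s.
Proof.
move=> ccg' dg eps eps0.
have [del [del0 osc]] := Cc_uniformly_continuous ccg' (eps := eps / 2) ltac:(lra).
exists del; split=> // s x s_del; rewrite -{2}(vadd_scal0 x (unit_vec i)).
have -> : eps * Rabs s = 2 * (eps / 2) * Rabs s by field.
apply: (mean_value_bound (fun t => has_partial_line x t dg)) => t ts; apply: osc => j.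
have -> : (x + t *: unit_vec i)%V j - x j = t * unit_vec i j by rewrite /vadd /vscal; ring.
by have := Rabs_scal_unit_vec_le i j t; lra.
Qed.

Lemma deriv_family_lin f g z D E : deriv_family f D -> deriv_family g E ->
  deriv_family (fun x => f x + z * g x)%C (fun l x => D l x + z * E l x)%C.
Proof.
move=> [D0 HD] [E0 HE]; split; first by rewrite D0 E0.
move=> l; have [[cD dD] [cE dE]] := (HD l, HE l).
by split=> [|i]; [exact: Ccont_lin | exact: has_partial_lin].
Qed.

Lemma deriv_family_shift f y D : deriv_family f D ->
  deriv_family (fun x => f (x + y)%V) (fun l x => D l (x + y)%V).
Proof.
move=> [D0 HD]; split; first by rewrite D0.
by move=> l; have [cD dD] := HD l; split=> [|i]; [exact: Ccont_shift | exact: has_partial_shift].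
Qed.

Lemma deriv_family0 : deriv_family (fun _ : Pt d => C0) (fun _ _ => C0).
Proof. by split=> // l; split=> [|i]; [exact: Ccont_const | exact: has_partial_const]. Qed.

Lemma deriv_family_sum (I : Type) (r : seq I) (c : I -> Cplx) (F : I -> Fn d)
    (D : I -> seq 'I_d -> Fn d) : (forall i, deriv_family (F i) (D i)) ->
  deriv_family (fun x => \sum_(i <- r) (c i * F i x))%C
    (fun l x => \sum_(i <- r) (c i * D i l x))%C.
Proof.
move=> HD; elim: r => [|i r IH].
  by have := deriv_family0; congr deriv_family; do ?[apply: funext => ?]; rewrite big_nil.
have := deriv_family_lin (c i) IH (HD i); congr deriv_family; do ?[apply: funext => ?];
by rewrite big_cons CaddC.
Qed.

Lemma deriv_family_Cc f D : Cc f -> deriv_family f D -> forall l, Cc (D l).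
Proof.
move=> [_ [M supp]] [D0 HD] l; split; first by case: (HD l).
exists M; elim: l => [|i l IH]; first by rewrite D0.
exact: has_partial_box_supp IH (proj2 (HD l) i).
Qed.

Definition smooth f := exists D, deriv_family f D.

Lemma smooth_coind (P : Fn d -> Prop) :
  (forall f, P f -> Ccont f /\ forall i, exists g, P g /\ has_partial i f g) ->
  forall f, P f -> smooth f.
Proof.
move=> HP f Pf.
have next i g : exists g', P g -> P g' /\ has_partial i g g'.
  by case: (pselect (P g)) => [/HP [_ /(_ i) [g' g'P]]|nPg]; [exists g' | exists g].
have /choice [D DP] i : exists Di, forall g, P g -> P (Di g) /\ has_partial i g (Di g).
  by have [Di DiP] := choice (next i); exists Di.
exists (foldr D f); split=> // l; have PD : P (foldr D f l) by elim: l => //= i l /DP; case/(_ i).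
by split=> [|i]; [case: (HP _ PD) | case: (DP i _ PD)].
Qed.

Lemma smooth_Ccont f : smooth f -> Ccont f.
Proof. by move=> [D [<- HD]]; case: (HD [::]). Qed.

Lemma smooth_partial f i : smooth f -> exists g, smooth g /\ has_partial i f g.
Proof.
move=> [D [<- HD]]; exists (D [:: i]); split; last exact: (proj2 (HD [::])).
by exists (fun l => D (l ++ [:: i])).
Qed.

Lemma smooth_conj f : smooth f -> smooth (fun x => Cconj (f x)).
Proof.
move=> [D [D0 HD]]; exists (fun l x => Cconj (D l x)); split; first by rewrite D0.
move=> l; have [/Ccont_seqP cD dD] := HD l; split=> [|i]; last exact: has_partial_conj.
by apply/Ccont_seqP => u x /cD [D1 D2]; split=> //; exact: CV_opp.
Qed.

Inductive smooth_products : Fn d -> Prop :=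
| smooth_productsM f g : smooth f -> smooth g -> smooth_products (fun x => f x * g x)%C
| smooth_productsD f g : smooth_products f -> smooth_products g ->
    smooth_products (fun x => f x + g x)%C.

Lemma smoothM f g : smooth f -> smooth g -> smooth (fun x => f x * g x)%C.
Proof.
move=> sf sg; apply: (smooth_coind (P := smooth_products)); last exact: smooth_productsM.
move=> {f g sf sg} h; elim=> {h} [f g sf sg|f g _ [cf df] _ [cg dg]]; split=> [|i].
- by apply: CcontM; exact: smooth_Ccont.
- have [[f' [sf' df']] [g' [sg' dg']]] := (smooth_partial i sf, smooth_partial i sg).
  exists (fun x => f' x * g x + f x * g' x)%C; split; last exact: has_partialM.
  by apply: smooth_productsD; exact: smooth_productsM.
- exact: (subspaceD (@Ccont_subspace d)).
have [[f' [Pf' df']] [g' [Pg' dg']]] := (df i, dg i).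
by exists (fun x => f' x + g' x)%C; split; [exact: smooth_productsD | exact: has_partialD].
Qed.

Lemma exp_poly_smooth f : exp_poly f -> smooth f.
Proof.
apply: smooth_coind => {}f Ef; split; first exact: exp_poly_Ccont.
move=> i; elim: Ef => [z|j|mu j|g h Eg [g' [Eg' dg]] Eh [h' [Eh' dh]]
  |g h Eg [g' [Eg' dg]] Eh [h' [Eh' dh]]].
- by exists (fun=> C0); split; [exact: exp_poly_const | exact: has_partial_const].
- exists (fun=> (unit_vec i j)%:C); split; first exact: exp_poly_const.
  apply/has_partialE => x; apply: cderiv_RtoC.
  rewrite (_ : (fun s => _) = fun s => unit_vec i j * s + x j).
    exact: derivable_pt_lim_affine.
  by apply: funext => s; rewrite /vadd /vscal; ring.
- exists (fun x => (unit_vec i j)%:C * (mu * expc mu (x j)))%C; split.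
    by do 2! (apply: exp_polyM; first exact: exp_poly_const); exact: exp_poly_expc.
  apply/has_partialE => x.
  have := cderiv_affine (a := unit_vec i j) (b := x j) (t := 0) (cderiv_expc mu _).
  rewrite Rmult_0_r Rplus_0_l => /cderiv_ext; apply=> // s.
  by congr expc; rewrite /vadd /vscal; ring.
- by exists (fun x => g' x + h' x)%C; split; [exact: exp_polyD | exact: has_partialD].
exists (fun x => g' x * h x + g x * h' x)%C; split; last exact: has_partialM.
by apply: exp_polyD; exact: exp_polyM.
Qed.

Lemma test_fnP f : test_fn f <-> smooth f /\ Cc f.
Proof.
split=> [[sf [r supp]]|[sf [_ [M supp]]]]; split=> //.
  by split; [exact: smooth_Ccont | exists r; exact: supp_in_box].
by exists (INR d * M); exact: box_supp_in.
Qed.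

Lemma test_fn_Cc f : test_fn f -> Cc f.
Proof. by case/test_fnP. Qed.

Lemma test_fn_subspace : subspace (@test_fn d).
Proof.
split=> [|c f g /test_fnP [[D HD] ccf] /test_fnP [[E HE] ccg]]; apply/test_fnP; split.
- by exists (fun _ _ => C0); exact: deriv_family0.
- by case: (Cc_subspace d).
- by exists (fun l x => D l x + c * E l x)%C; exact: deriv_family_lin.
- exact: Cc_lin.
Qed.

Lemma test_fn_shift f y : test_fn f -> test_fn (fun x => f (x + y)%V).
Proof.
move=> /test_fnP [[D HD] ccf]; apply/test_fnP; split; last exact: Cc_shift.
by exists (fun l x => D l (x + y)%V); exact: deriv_family_shift.
Qed.

Lemma test_fnM f g : smooth f -> test_fn g -> test_fn (fun x => f x * g x)%C.
Proof.
move=> sf /test_fnP [sg ccg]; apply/test_fnP.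
by split; [exact: smoothM | apply: CcM => //; exact: smooth_Ccont].
Qed.

End Smooth.

(** * Convolution *)

Section Convolution.
Variable d : nat.
Implicit Types f g phi psi : Fn d.

Definition pairing g phi : Cplx := integral (fun x => g x * phi x)%C.

Lemma pairing_linl f g phi z : Ccont f -> Ccont g -> Cc phi ->
  pairing (fun x => f x + z * g x)%C phi = (pairing f phi + z * pairing g phi)%C.
Proof.
move=> cf cg ccphi; rewrite /pairing -integral_lin; try exact: CcM.
by congr integral; apply: funext => x; ring.
Qed.

Lemma pairingBl f g phi : Ccont f -> Ccont g -> Cc phi ->
  pairing (fun x => f x - g x)%C phi = (pairing f phi - pairing g phi)%C.
Proof.
move=> cf cg ccphi; rewrite /pairing -integralB; try exact: CcM.
by congr integral; apply: funext => x; ring.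
Qed.

Lemma pairing_sumr (I : Type) (r : seq I) (c : I -> Cplx) (F : I -> Fn d) g : Ccont g ->
  (forall i, Cc (F i)) ->
  pairing g (fun x => \sum_(i <- r) (c i * F i x))%C = (\sum_(i <- r) (c i * pairing g (F i)))%C.
Proof.
move=> cg ccF; rewrite /pairing -(integral_sum r c (fun i => CcM cg (ccF i))).
by congr integral; apply: funext => x; rewrite Cmul_sumr; apply: eq_bigr => i _; ring.
Qed.

Lemma pairing_bound phi : Cc phi -> exists K, 0 < K /\ forall g B, Ccont g ->
  (forall y, Cnorm (g y) <= B) -> Cnorm (pairing g phi) <= B * K.
Proof.
move=> ccphi; have [M [M0 supp]] := Cc_supp ccphi; have [B [B0 phiB]] := Cc_bounded ccphi.
have vol0 := box_volume_gt0 d M0.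
exists ((B + 1) * box_volume d M); split; first by apply: Rmult_lt_0_compat; lra.
move=> g B' cg gB'; rewrite -Rmult_assoc; apply: integral_bound => //; first exact: CcM.
  exact: box_suppMr.
move=> y; rewrite CnormM; apply: Rmult_le_compat; try exact: Cnorm_ge0; first exact: gB'.
by have := phiB y; lra.
Qed.

Definition conv phi psi : Fn d := fun x => pairing (fun y => psi (x - y)%V) phi.

Lemma Ccont_reflect psi x : Ccont psi -> Ccont (fun y => psi (x - y)%V).
Proof. by move/(Ccont_affine (-1) x)/subst_eqfun; apply=> y; rewrite vaddC. Qed.

Lemma conv_integrand_eq0 M M' phi psi x y i : box_supp M phi -> box_supp M' psi ->
  M + M' < Rabs (x i) -> (psi (x - y)%V * phi y = 0)%C.
Proof.
move=> supp supp' xi; case: (Rlt_le_dec M (Rabs (y i))) => yi; first by rewrite (supp y i yi); ring.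
rewrite (supp' _ i); first by ring.
rewrite /vadd /vscal; have := Rabs_triang (x i + -1 * y i) (y i).
by rewrite (_ : _ + _ + _ = x i); [lra | ring].
Qed.

Lemma conv_box_supp M M' phi psi :
  box_supp M phi -> box_supp M' psi -> box_supp (M + M') (conv phi psi).
Proof.
move=> supp supp' x i xi; rewrite /conv /pairing -(integral0 d); congr integral.
by apply: funext => y; exact: conv_integrand_eq0 supp supp' xi.
Qed.

Lemma conv_comm phi psi : Cc phi -> Cc psi -> conv phi psi = conv psi phi.
Proof.
move=> ccphi ccpsi; apply: funext => x; rewrite /conv /pairing.
have ccx : Cc (fun y => psi (x - y)%V * phi y)%C.
  by apply: CcM => //; apply: Ccont_reflect; case: ccpsi.
rewrite -(integral_shift x ccx) -(integral_opp (Cc_shift x ccx)).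
congr integral; apply: funext => y.
have -> : (- y + x)%V = (x - y)%V by pt_ring.
by have -> : (x - (x - y))%V = y; [pt_ring | ring].
Qed.

Lemma conv_Ccont phi psi : Cc phi -> Cc psi -> Ccont (conv phi psi).
Proof.
move=> ccphi ccpsi; have [cpsi _] := ccpsi; have [K [K0 bound]] := pairing_bound ccphi.
apply/Ccont_withinP => x eps eps0.
have e0 : 0 < eps / (2 * K) by apply: Rdiv_lt_0_compat; lra.
have [del [del0 osc]] := Cc_uniformly_continuous ccpsi e0.
exists del; split=> // x' x'x; rewrite /conv -pairingBl //; try exact: Ccont_reflect.
have -> : eps = 2 * (eps / (2 * K) * K) by field; lra.
apply: (Rle_lt_trans _ (eps / (2 * K) * K)); last by have := Rmult_lt_0_compat _ _ e0 K0; lra.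
apply: bound => [|y]; first by apply: (subspaceB (@Ccont_subspace d)); exact: Ccont_reflect.
by apply: osc => i; have := x'x i; congr (Rabs _ <= _); rewrite /vadd; ring.
Qed.

Lemma conv_has_partial i phi psi psi' : Cc phi -> Cc psi -> Cc psi' ->
  has_partial i psi psi' -> has_partial i (conv phi psi) (conv phi psi').
Proof.
move=> ccphi [cpsi _] ccpsi' dpsi; have [cpsi' _] := ccpsi'.
have [K [K0 bound]] := pairing_bound ccphi.
apply/has_partialE => x; apply: cderiv_of_estimate => eps eps0.
have [del [del0 quot]] := uniform_difference_quotient ccpsi' dpsi (Rdiv_lt_0_compat _ _ eps0 K0).
exists del; split=> // s s_del; rewrite vadd_scal0.
pose q y := (psi (x + s *: unit_vec i - y)%V - psi (x - y)%V)%C.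
have cq : Ccont q by apply: (subspaceB (@Ccont_subspace d)); exact: Ccont_reflect.
have -> : (conv phi psi (x + s *: unit_vec i)%V - conv phi psi x - s%:C * conv phi psi' x)%C =
    pairing (fun y => q y + - s%:C * psi' (x - y)%V)%C phi.
  rewrite pairing_linl // ?pairingBl //; try exact: Ccont_reflect.
  by rewrite /conv; ring.
have -> : eps * Rabs s = (eps / K * Rabs s) * K by field; lra.
apply: bound => [|y]; first by apply: Ccont_lin => //; exact: Ccont_reflect.
have := quot s (x - y)%V s_del; congr (Cnorm _ <= _); rewrite /q.
have -> : (x - y + s *: unit_vec i)%V = (x + s *: unit_vec i - y)%V by pt_ring.
by ring.
Qed.

Lemma conv_deriv_family phi psi D : Cc phi -> Cc psi -> deriv_family psi D ->
  deriv_family (conv phi psi) (fun l => conv phi (D l)).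
Proof.
move=> ccphi ccpsi HD; have ccD := deriv_family_Cc ccpsi HD; have [D0 dD] := HD.
split=> [|l]; first by rewrite D0.
by split=> [|i]; [exact: conv_Ccont | apply: conv_has_partial => //; case: (dD l)].
Qed.

Lemma conv_test_fn phi psi : Cc phi -> test_fn psi -> test_fn (conv phi psi).
Proof.
move=> ccphi /test_fnP [[D HD] ccpsi]; apply/test_fnP; split.
  by exists (fun l => conv phi (D l)); exact: conv_deriv_family.
have [[_ [M supp]] [_ [M' supp']]] := (ccphi, ccpsi).
by split; [exact: conv_Ccont | exists (M + M'); exact: conv_box_supp].
Qed.

Definition translate (y : Pt d) phi : Fn d := fun x => phi (x - y)%V.

Lemma translate_test_fn y phi : test_fn phi -> test_fn (translate y phi).
Proof. exact: test_fn_shift. Qed.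

Lemma translate_box_supp M M' phi y :
  (forall i, Rabs (y i) <= M') -> box_supp M phi -> box_supp (M + M') (translate y phi).
Proof.
move=> yM; apply: box_supp_shift => i; rewrite /vscal Rabs_mult Rabs_Ropp Rabs_R1 Rmult_1_l.
exact: yM.
Qed.

Lemma translate_test_conv phi u y : test_fn phi -> pt_cv u y ->
  test_conv (fun n => translate (u n) phi) (translate y phi).
Proof.
move=> /test_fnP [[D HD] ccphi] uy; have [M [M0 supp]] := Cc_supp ccphi.
have /choice [b ub] i : exists b, forall n, Rabs (u n i) <= b.
  by have [b [_ ub]] := maj_by_pos _ (exist _ _ (uy i)); exists b.
pose M' := vnorm b + vnorm y.
have [b0 y0] := (vnorm_ge0 b, vnorm_ge0 y).
exists (INR d * (M + M')); split; [|split] => [|n|].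
- apply/box_supp_in/translate_box_supp => // i.
  by have := Rabs_coord_le_vnorm y i; rewrite /M'; lra.
- apply/box_supp_in/translate_box_supp => // i.
  by have := ub i n; have := Rle_abs (b i); have := Rabs_coord_le_vnorm b i; rewrite /M'; lra.
exists (fun n l => translate (u n) (D l)), (fun l => translate y (D l)).
split; [|split] => [|n|l eps eps0]; try exact: deriv_family_shift.
have ccD := deriv_family_Cc ccphi HD l.
have [del [del0 osc]] := Cc_uniformly_continuous ccD (eps := eps / 2) ltac:(lra).
have [N uN] := proj1 (pt_cvP _ _) uy del del0.
exists N => n x /uN uny; apply: (Rle_lt_trans _ (eps / 2)); last by lra.
apply: osc => i; have := uny i; rewrite -Rabs_Ropp; congr (Rabs _ <= _).
by rewrite /vadd /vscal; ring.
Qed.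

Lemma conv_integrand_modulus phi psi : Cc phi -> Cc psi ->
  forall eps, 0 < eps -> exists del, 0 < del /\ forall x y z, within del y z ->
    Cnorm (psi (x - y)%V * phi y - psi (x - z)%V * phi z) <= eps.
Proof.
move=> ccphi ccpsi eps eps0.
have [B1 [B1_ge0 phiB]] := Cc_bounded ccphi; have [B2 [B2_ge0 psiB]] := Cc_bounded ccpsi.
have e0 : 0 < eps / (B1 + B2 + 1) by apply: Rdiv_lt_0_compat; lra.
have [del1 [del1_gt0 osc1]] := Cc_uniformly_continuous ccphi e0.
have [del2 [del2_gt0 osc2]] := Cc_uniformly_continuous ccpsi e0.
exists (Rmin del1 del2); split=> [|x y z yz]; first exact: Rmin_pos.
have -> : (psi (x - y)%V * phi y - psi (x - z)%V * phi z =
    (psi (x - y)%V - psi (x - z)%V) * phi y + psi (x - z)%V * (phi y - phi z))%C by ring.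
apply: Rle_trans (Cnorm_triangle _ _) _; rewrite !CnormM.
have phi_yz : Cnorm (phi y - phi z) <= eps / (B1 + B2 + 1).
  by apply: osc1 => i; apply: Rle_trans (yz i) (Rmin_l _ _).
have psi_yz : Cnorm (psi (x - y)%V - psi (x - z)%V) <= eps / (B1 + B2 + 1).
  apply: osc2 => i; apply: Rle_trans (Rle_trans _ _ _ (yz i) (Rmin_r _ _)).
  by rewrite -Rabs_Ropp; apply: Req_le; congr Rabs; rewrite /vadd /vscal; ring.
have := Rmult_le_compat _ _ _ _ (Cnorm_ge0 _) (Cnorm_ge0 _) psi_yz (phiB y).
have := Rmult_le_compat _ _ _ _ (Cnorm_ge0 _) (Cnorm_ge0 _) (psiB (x - z)%V) phi_yz.
have : eps / (B1 + B2 + 1) * (B1 + B2 + 1) = eps by field; lra.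
by lra.
Qed.

Section ConvolutionSums.
Variables (M : R) (phi : Fn d).
Hypotheses (M0 : 0 <= M) (ccphi : Cc phi) (supp : box_supp M phi).

Definition conv_sum (N : nat) psi : Fn d := fun x =>
  (\sum_(k <- grid_box d M N) ((/ INR N ^ d)%:C * phi (grid N k) * translate (grid N k) psi x))%C.

Lemma conv_sumE N psi x : (0 < N)%N ->
  conv_sum N psi x = grid_sum N (fun y => psi (x - y)%V * phi y)%C.
Proof.
move=> N0; rewrite (grid_sum_box N0 M0 (box_suppMr _ supp)) Cmul_sumr /conv_sum.
by apply: eq_bigr => k _; rewrite /translate; ring.
Qed.

Lemma conv_sum_uniform psi : Cc psi -> forall eps, 0 < eps ->
  exists N, forall n x, (N <= n)%N -> Cnorm (conv_sum n.+1 psi x - conv phi psi x) < eps.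
Proof.
move=> ccpsi eps eps0; have vol0 : 0 < box_volume d (M + 1) by apply: box_volume_gt0; lra.
have e0 : 0 < eps / (2 * box_volume d (M + 1)) by apply: Rdiv_lt_0_compat; lra.
have [del [del0 modulus]] := conv_integrand_modulus ccphi ccpsi e0.
have [N inv_small] := invS_small del0; exists N => n x Nn.
rewrite conv_sumE // Cnorm_subC; apply: (Rle_lt_trans _ (eps / 2)); last by lra.
have -> : eps / 2 = eps / (2 * box_volume d (M + 1)) * box_volume d (M + 1) by field; lra.
apply: integral_error => //; last first.
- by move=> y z yz; apply: modulus => i; apply: Rle_trans (yz i) (Rlt_le _ _ (inv_small n Nn)).
- exact: box_suppMr.
by apply: CcM => //; apply: Ccont_reflect; case: ccpsi.
Qed.

Lemma conv_sum_test_fn N psi : test_fn psi -> test_fn (conv_sum N psi).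
Proof.
move=> tpsi; apply: (subspace_sum _ (F := fun k x => _ * translate (grid N k) psi x)%C) => [|k _].
  exact: test_fn_subspace.
by apply: subspaceZ; [exact: test_fn_subspace | exact: translate_test_fn].
Qed.

Lemma conv_sum_test_conv psi : test_fn psi ->
  test_conv (fun n => conv_sum n.+1 psi) (conv phi psi).
Proof.
move=> /test_fnP [[D HD] ccpsi]; have [M' [M'0 supp']] := Cc_supp ccpsi.
exists (INR d * (M + M')); split; [|split] => [|n|].
- exact/box_supp_in/conv_box_supp.
- apply: box_supp_in => x i xi; rewrite /conv_sum big1 // => k _.
  have := conv_integrand_eq0 (grid n.+1 k) supp supp' xi; rewrite -/(translate _ _ _) => eq0.
  by rewrite -CmulA (CmulC (phi _)) eq0; ring.
exists (fun n l => conv_sum n.+1 (D l)), (fun l => conv phi (D l)).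
split; first exact: conv_deriv_family.
split=> [n|l]; last exact/conv_sum_uniform/(deriv_family_Cc ccpsi HD).
apply: (deriv_family_sum _ _ (D := fun k l => translate (grid n.+1 k) (D l))) => k.
exact: deriv_family_shift.
Qed.

End ConvolutionSums.
End Convolution.

(** * Distributions *)

Record test_function d := TestFunction { test_val :> Fn d; test_valP : test_fn test_val }.

HB.instance Definition _ d := gen_eqMixin (test_function d).

Lemma test_lincomb_subproof d (r : seq (Cplx * test_function d)) :
  test_fn (fun x => \sum_(p <- r) (p.1 * test_val p.2 x))%C.
Proof.
apply: (subspace_sum _ (F := fun p x => p.1 * test_val p.2 x)%C) => [|p _].
  exact: test_fn_subspace.
by apply: subspaceZ; [exact: test_fn_subspace | exact: test_valP].
Qed.

Definition test_lincomb d (r : seq (Cplx * test_function d)) : test_function d :=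
  TestFunction (test_lincomb_subproof r).

Lemma pairing_translate d (e phi : Fn d) y : Ccont e -> test_fn phi ->
  pairing e (translate y phi) = pairing (fun x => e (x + y)%V) phi.
Proof.
move=> ce tphi; rewrite /pairing -(integral_shift y); last first.
  by apply: CcM => //; exact/test_fn_Cc/translate_test_fn.
congr integral; apply: funext => x; rewrite /translate.
by have -> : (x + y - y)%V = x by pt_ring.
Qed.

Section PairingFunctionals.
Variable d : nat.

Definition pairing_functional (g : Fn d) : test_function d -> Cplx := fun phi => pairing g phi.

Lemma pairing_functional_lin c (f g : Fn d) : Ccont f -> Ccont g ->
  pairing_functional (fun x => f x + c * g x)%C =1
  fun phi => (pairing_functional f phi + c * pairing_functional g phi)%C.
Proof. by move=> cf cg phi; exact: pairing_linl (test_fn_Cc (test_valP phi)). Qed.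

Lemma linear_pairing_functional (g : Fn d) :
  Ccont g -> linear_functional (@test_lincomb d) (pairing_functional g).
Proof. by move=> cg r; apply: pairing_sumr => // p; exact/test_fn_Cc/test_valP. Qed.

Lemma in_span_pairing_functional (s : seq (Fn d)) g : (forall u, u \in s -> Ccont u) ->
  Ccont g -> in_span s g -> in_span [seq pairing_functional u | u <- s] (pairing_functional g).
Proof. exact: in_span_map (@Ccont_subspace d) pairing_functional_lin. Qed.

Lemma pairing_translates_finite_rank (e : Fn d) : exp_poly e ->
  finite_rank (fun y (phi : test_function d) => pairing e (translate y phi)).
Proof.
move=> Ee; have [s [Es se]] := exp_poly_finite_rank Ee; have ce := exp_poly_Ccont Ee.
exists [seq pairing_functional u | u <- s] => y.
have cs u : u \in s -> Ccont u by move=> /Es; exact: exp_poly_Ccont.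
have sey := in_span_pairing_functional cs (Ccont_shift y ce) (se y).
apply: subst_eqfun sey _ => phi; apply: esym; apply: pairing_translate => //.
exact: test_valP.
Qed.

Definition exp_poly_functional (w : test_function d -> Cplx) :=
  exists e, exp_poly e /\ w =1 pairing_functional e.

Lemma exp_poly_functional_subspace : subspace exp_poly_functional.
Proof.
split.
  exists (fun=> C0); split=> [|phi]; first exact: exp_poly_const.
  by rewrite -[LHS](integral0 d); congr integral; apply: funext => x; ring.
move=> c u v [e [Ee uE]] [e' [Ee' vE]]; exists (fun x => e x + c * e' x)%C.
split=> [|phi]; first exact: (proj2 (@exp_poly_subspace d)).
by rewrite pairing_functional_lin ?uE ?vE //; exact: exp_poly_Ccont.
Qed.

End PairingFunctionals.

Lemma induced_pairing d (e : Fn d) T : Ccont e ->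
  induced e T <-> forall phi, test_fn phi -> T phi = pairing e phi.
Proof.
move=> ce; split=> Te phi tphi; have cv := integral_riemann (CcM ce (test_fn_Cc tphi)).
  exact: Cv_unique (Te phi tphi) cv.
by rewrite Te.
Qed.

Section Distribution.
Variables (d : nat) (T : Fn d -> Cplx).
Hypothesis distT : distribution T.
Implicit Types phi psi : Fn d.

Lemma dist_lin phi psi z : test_fn phi -> test_fn psi ->
  T (fun x => phi x + z * psi x)%C = (T phi + z * T psi)%C.
Proof.
move=> tphi tpsi; have [TD [TZ _]] := distT; rewrite TD // ?TZ //.
exact: subspaceZ (@test_fn_subspace d) tpsi.
Qed.

Lemma dist0 : T (fun=> C0) = C0.
Proof.
have [t0 _] := @test_fn_subspace d; have [_ [TZ _]] := distT.
by rewrite -[RHS](Cmul0z (T (fun=> C0))) -TZ //; congr T; apply: funext => x; ring.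
Qed.

Lemma dist_sum (I : Type) (r : seq I) (c : I -> Cplx) (F : I -> Fn d) : (forall i, test_fn (F i)) ->
  T (fun x => \sum_(i <- r) (c i * F i x))%C = (\sum_(i <- r) (c i * T (F i)))%C.
Proof.
move=> tF; have sub := @test_fn_subspace d; elim: r => [|i r IH].
  by rewrite big_nil -[RHS]dist0; congr T; apply: funext => x; rewrite big_nil.
rewrite big_cons -IH CaddC -dist_lin //; last first.
  by apply: (subspace_sum _ (F := fun j x => c j * F j x)%C) => // j _; exact: subspaceZ.
by congr T; apply: funext => x; rewrite big_cons CaddC.
Qed.

(* In the usual notation this is the convolution of [T] with the reflection of [phi]. *)
Definition regularize phi : Fn d := fun y => T (translate y phi).

Lemma regularize0 phi : regularize phi 0%V = T phi.
Proof. by congr T; apply: funext => x; congr phi; pt_ring. Qed.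

Lemma regularize_translate phi y z :
  regularize phi (y + z)%V = regularize (translate z phi) y.
Proof. by congr T; apply: funext => x; congr phi; pt_ring. Qed.

Lemma regularize_Ccont phi : test_fn phi -> Ccont (regularize phi).
Proof.
move=> tphi; apply/Ccont_seqP => u y uy; have [_ [_ contT]] := distT.
by apply: contT => [n||]; [exact: translate_test_fn .. | exact: translate_test_conv].
Qed.

Lemma dist_conv phi psi : test_fn phi -> test_fn psi ->
  T (conv phi psi) = pairing (regularize psi) phi.
Proof.
move=> tphi tpsi; have ccphi := test_fn_Cc tphi; have [M [M0 supp]] := Cc_supp ccphi.
have [_ [_ contT]] := distT; have creg := regularize_Ccont tpsi.
have := contT _ _ (fun n => conv_sum_test_fn M phi n.+1 tpsi) (conv_test_fn ccphi tpsi)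
  (conv_sum_test_conv M0 ccphi supp tpsi).
move/Cv_unique; apply; apply: Cv_ext (integral_grid_sum (CcM creg ccphi)) _ => n.
rewrite (dist_sum _ _ (F := fun k => translate (grid n.+1 k) psi)) => [|k]; last first.
  exact: translate_test_fn.
rewrite (grid_sum_box _ M0 (box_suppMr _ supp)) // Cmul_sumr; apply: eq_bigr => k _.
by rewrite /regularize; ring.
Qed.

Lemma regularize_symmetry phi psi : test_fn phi -> test_fn psi ->
  pairing (regularize psi) phi = pairing (regularize phi) psi.
Proof.
by move=> tphi tpsi; rewrite -!dist_conv // conv_comm //; exact: test_fn_Cc.
Qed.

(* The test function [psi = conj(F) |phi(. + x0)|^2], where [F = regularize phi] and
   [phi x0 <> 0], makes the integrand [|F|^2 |phi(. + x0)|^2] nonnegative, so that no bump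
   function has to be constructed. *)
Lemma eq0_of_regularize_weak_eq0 phi : test_fn phi -> exp_poly (regularize phi) ->
  (forall psi, test_fn psi -> pairing (regularize phi) psi = 0%C) -> T phi = 0%C.
Proof.
move=> tphi EF weak0; pose F := regularize phi.
case: (pselect (forall x, phi x = 0%C)) => [/funext -> |/existsNP [x0 phi_x0]]; first exact: dist0.
pose s x := phi (x + x0)%V; pose psi x := (Cconj (F x) * (Cconj (s x) * s x))%C.
have ts : test_fn s by exact: test_fn_shift.
have tpsi : test_fn psi.
  apply: test_fnM; first exact/smooth_conj/exp_poly_smooth.
  by apply: test_fnM => //; apply/smooth_conj; case/test_fnP: ts.
have sqr_sum (z : Cplx) : fst z ^ 2 + snd z ^ 2 = Cnorm z ^ 2.
  by rewrite /Cnorm pow2_sqrt //; nra.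
have FpsiE x : fst (F x * psi x)%C = Cnorm (F x) ^ 2 * Cnorm (s x) ^ 2.
  by rewrite -!sqr_sum /psi /Cmul /Cconj /=; ring.
have Fpsi_ge0 x : 0 <= fst (F x * psi x)%C.
  by rewrite FpsiE; apply: Rmult_le_pos; exact: pow2_ge_0.
have ccFpsi : Cc (fun x => F x * psi x)%C by apply: CcM (exp_poly_Ccont EF) (test_fn_Cc tpsi).
have := integral_eq0 0%V ccFpsi Fpsi_ge0 (weak0 psi tpsi).
have sqr_eq0 (z : Cplx) : Cnorm z ^ 2 = 0 -> z = 0%C by move=> z0; apply: Cnorm_eq0; nra.
rewrite FpsiE /F regularize0 /s vadd0x => /Rmult_integral [] /sqr_eq0 //.
Qed.

Hypothesis rankT : finite_rank (fun y (phi : test_function d) => regularize phi y).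

Lemma regularize_in_span : exists r : seq (test_function d), forall phi : test_function d,
  in_span [seq regularize psi | psi : test_function d <- r] (regularize phi).
Proof.
have [l regE] := finite_rank_interpolate rankT.
exists (unzip1 l) => phi; rewrite /unzip1 -map_comp.
apply: subst_eqfun (in_span_lincomb l (fun q => q.2 phi) (fun q => regularize q.1)) _ => y.
by rewrite (regE y phi); apply: eq_bigr => q _; ring.
Qed.

Lemma regularize_exp_poly phi : test_fn phi -> exp_poly (regularize phi).
Proof.
move=> tphi; apply: finite_rank_exp_poly; first exact: regularize_Ccont.
have [r rphi] := regularize_in_span; exists [seq regularize psi | psi : test_function d <- r] => z.
apply: subst_eqfun (rphi (TestFunction (translate_test_fn z tphi))) _ => y.
by rewrite regularize_translate.
Qed.

Lemma finite_rank_dist_exp_poly : dist_exp_poly T.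
Proof.
have [r r_span] := regularize_in_span.
pose s := [seq regularize psi | psi : test_function d <- r].
have Es u : u \in s -> exp_poly u by move=> /mapP [psi _ ->]; exact/regularize_exp_poly/test_valP.
have functionals_span (psi : test_function d) :
    in_span [seq pairing_functional u | u <- s] (pairing_functional (regularize psi)).
  apply: in_span_pairing_functional => // [u /Es|]; first exact: exp_poly_Ccont.
  exact/regularize_Ccont/test_valP.
have T_span : in_span [seq pairing_functional u | u <- s] (fun phi : test_function d => T phi).
  apply: (in_span_of_common_kernel (lincomb := @test_lincomb d)) => [|q|phi ker].
  - by move=> _ /mapP [u /Es Eu ->]; exact/linear_pairing_functional/exp_poly_Ccont.
  - by rewrite dist_sum // => p; exact: test_valP.
  have tphi := test_valP phi.
  apply: eq0_of_regularize_weak_eq0 => // [|psi tpsi]; first exact: regularize_exp_poly.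
  rewrite -(regularize_symmetry tphi tpsi).
  exact: in_span_eq0 (functionals_span (TestFunction tpsi)) ker.
have [e [Ee Te]] : exp_poly_functional (fun phi : test_function d => T phi).
  apply: span_min T_span => [|_ /mapP [u /Es Eu ->]]; first exact: exp_poly_functional_subspace.
  by exists u.
exists e; split; first exact/is_exp_polyP.
apply/induced_pairing => [|phi tphi]; first exact: exp_poly_Ccont.
exact: (Te (TestFunction tphi)).
Qed.

End Distribution.

Lemma DeltaD_translate d (h : Pt d) m T y phi : distribution T -> test_fn phi ->
  DeltaD h m T (translate y phi) =
  (\sum_(j < m.+1) (diff_coef m j * regularize T phi (y + INR j *: h)%V))%C.
Proof.
move=> distT tphi; rewrite /regularize.
rewrite -(dist_sum distT _ (fun j : 'I_m.+1 => diff_coef m j)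
  (F := fun j : 'I_m.+1 => translate (y + INR j *: h)%V phi)) => [|j]; last first.
  exact: translate_test_fn.
congr T; apply: funext => x; apply: eq_bigr => j _; congr Cmul; congr phi.
by pt_ring.
Qed.

Theorem dist_exp_poly_of_differences (d t : nat) (h : 'I_t -> Pt d) (m : 'I_t -> nat)
    (T : Fn d -> Cplx) :
  dense_subgroup h -> distribution T ->
  (forall k : 'I_t, dist_exp_poly (DeltaD (h k) (m k) T)) -> dist_exp_poly T.
Proof.
move=> dense distT exp_diff; apply: finite_rank_dist_exp_poly => //.
apply: (finite_rank_of_differences (m := m)) dense _ => [k|phi]; last first.
  exact/regularize_Ccont/test_valP.
have [e [/is_exp_polyP Ee /(induced_pairing _ (exp_poly_Ccont Ee)) diffE]] := exp_diff k.
have [s se] := pairing_translates_finite_rank Ee; exists s => y.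
apply: subst_eqfun (se y) _ => phi; have tphi := test_valP phi.
by rewrite -diffE ?DeltaD_translate //; exact: translate_test_fn.
Qed.

Theorem theorem4 :
  (* case X_d = C(R^d) *)
  (forall (d t : nat) (h : 'I_t -> Pt d) (m : 'I_t -> nat) (f : Fn d),
     dense_subgroup h -> Ccont f ->
     (forall k : 'I_t, is_exp_poly (FDelta (h k) (m k) f)) ->
     is_exp_poly f) /\
  (* case X_d = D(R^d)' *)
  (forall (d t : nat) (h : 'I_t -> Pt d) (m : 'I_t -> nat) (T : Fn d -> Cplx),
     dense_subgroup h -> distribution T ->
     (forall k : 'I_t, dist_exp_poly (DeltaD (h k) (m k) T)) ->
     dist_exp_poly T).
Proof.
split; [exact: is_exp_poly_of_differences | exact: dist_exp_poly_of_differences].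
Qed.
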